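(* Let $x,y,z$ be nonnegative integers with $x\equiv z \pmod 2$, and let $\mathbf a=(a_1,\dots,a_m)$, $\mathbf b=(b_1,\dots,b_n)$, $\mathbf c=(c_1,\dots,c_k)$ be sequences of nonnegative integers with $m,n,k$ positive even integers. Put $h=\frac{x+z}{2}$. (a) If $a\ge b$, then \begin{align*} \operatorname{M}(R^{\odot}_{x,y,z}(\mathbf a;\mathbf c;\mathbf b))=&\operatorname{M}(C_{x,2y+z+2a,z}(c))\\ &\times s\left(y,a_1,\dots,a_m,h,c_1,\dots,c_{k-1},c_k+h+b_n,b_{n-1},\dots,b_1\right)\\ &\times s\left(a_1,\dots,a_{m-1},a_m+h+c_1,c_2,\dots,c_k,h,b_n,\dots,b_1,y+a-b\right)\\ &\times \frac{\operatorname{H}(c+h)}{\operatorname{H}(c)\operatorname{H}(h)}\frac{\operatorname{H}(a+y+h)}{\operatorname{H}(a+c+y+h)}\\ &\times \frac{\operatorname{H}(a+y+z)\operatorname{H}(a+c+y+z)}{\operatorname{H}(e_a+o_b+o_c+y+z)\operatorname{H}(a+o_a-o_b+e_c+y+z)}\\ &\times \frac{\operatorname{H}(e_a+o_b+o_c+y)\operatorname{H}(a+o_a-o_b+e_c+y)}{\operatorname{H}(a+y)^2}. \end{align*} (b) If $a<b$, then \begin{align*} \operatorname{M}(R^{\odot}_{x,y,z}(\mathbf a;\mathbf c;\mathbf b))=&\operatorname{M}(C_{x,2y+z+2b,z}(c))\\ &\times s\left(y+b-a,a_1,\dots,a_m,h,c_1,\dots,c_{k-1},c_k+h+b_n,b_{n-1},\dots,b_1\right)\\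 &\times s\left(a_1,\dots,a_{m-1},a_m+h+c_1,c_2,\dots,c_k,h,b_n,\dots,b_1,y\right)\\ &\times \frac{\operatorname{H}(c+h)}{\operatorname{H}(c)\operatorname{H}(h)}\frac{\operatorname{H}(b+y+h)}{\operatorname{H}(b+c+y+h)}\\ &\times \frac{\operatorname{H}(b+y+z)\operatorname{H}(b+c+y+z)}{\operatorname{H}(b+o_b-o_a+o_c+y+z)\operatorname{H}(o_a+e_b+e_c+y+z)}\\ &\times \frac{\operatorname{H}(b+o_b-o_a+o_c+y)\operatorname{H}(o_a+e_b+e_c+y)}{\operatorname{H}(b+y)^2}. \end{align*}
   Context: Work on the triangular lattice drawn with horizontal lattice lines. A lozenge is the union of two unit triangles sharing an edge; a (lozenge) tiling of a region is a covering by lozenges without gaps or overlaps; $\operatorname{M}(R)$ denotes the number of tilings of $R$. Vertical distances are measured in rows (the height of a unit triangle); ''the horizontal lattice line at level $t$ above a point $P$'' is the horizontal lattice line $t$ rows above $P$. Lattice hexagons have all angles $120^\circ$ and their side-lengths are listed clockwise starting from the horizontal top side: north, northeast, southeast, south, southwest, northwest. The east vertex is the common vertex of the northeast and southeast sides; the west vertex is the common vertex of the southwest and northwest sides. Hyperfactorial: $\operatorname{H}(n)=0!\,1!\cdots(n-1)!$ for nonnegative integers $n$ ($\operatorname{H}(0)=1$). For a sequence $\mathbf t=(t_1,\dots,t_r)$ of nonnegative integers, $o_t=\sum_{i\text{ odd}}t_i$, $e_t=\sum_{i \text{ even}}t_i$, and $t=t_1+\dots+t_r$; so $a,b,c,o_a,e_a,o_b,\dots$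 refer to $\mathbf a,\mathbf b,\mathbf c$. Dented semihexagon: $s(t_1,\dots,t_r)$ is the number of tilings of the region $S(t_1,\dots,t_r)$ obtained from the trapezoid with horizontal top side of length $e_t$, horizontal bottom side of length $o_t+e_t$, and two slanted sides of length $o_t$ (the upper half of a hexagon with sides $e_t,o_t,o_t,e_t,o_t,o_t$), by removing from its bottom side up-pointing triangles of side-lengths $t_1,t_3,t_5,\dots$ from left to right, the first starting at the left end of the bottom side and consecutive removed triangles separated along the bottom side by distances $t_2,t_4,\dots$. (Equivalently, by Cohn–Larsen–Propp, $s(t_1,\dots,t_{2l-1})=s(t_1,\dots,t_{2l})=\frac{1}{\operatorname{H}(t_1+t_3+\dots+t_{2l-1})}\frac{\prod_{1\le i<j\le 2l-1,\ j-i\text{ odd}}\operatorname{H}(t_i+\dots+t_j)}{\prod_{1\le i<j\le 2l-1,\ j-i\text{ even}}\operatorname{H}(t_i+\dots+t_j)}$.) Cored hexagon: for nonnegative integers $X,Y,Z,p$, $C_{X,Y,Z}(p)$ is obtained from the hexagon $H$ with side-lengths $X,Y+p,Z,X+p,Y,Z+p$ as follows. Let $H_0$ be the hexagon with side-lengths $X,Y,Z,X,Y,Z$ whose south, southwest and northwest sides lie on the lines of the south, southwest and northwest sides of $H$; let $O$ be the center of symmetry of $H_0$. Remove the up-pointing triangle of side $p$ whose left vertex is: $O$ if $X,Y,Z$ all have the same parity; the point $1/2$ unit west of $O$ if $X$ has parity different from $Y$ and $Z$; the point $1/2$ unit from $O$ in the northwest lattice direction if $Y$ has parity different from $X$ and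 $Z$; the point $1/2$ unit from $O$ in the southwest lattice direction if $Z$ has parity different from $X$ and $Y$. Fern: a string of lattice triangles of side-lengths $t_1,\dots,t_r$ (side $0$ allowed) with alternating orientations, all having a horizontal side on a common horizontal lattice line $\ell$ (up-pointing ones above $\ell$, down-pointing ones below), consecutive triangles meeting at a vertex on $\ell$; it occupies a segment of $\ell$ of length $t_1+\dots+t_r$. Removing a fern means removing the union of its triangles. The region $R^{\odot}_{x,y,z}(\mathbf a;\mathbf c;\mathbf b)$ (for $x\equiv z \pmod 2$): let $H$ be the hexagon with side-lengths $x+o_a+e_b+e_c$, $2y+z+e_a+o_b+o_c+|a-b|$, $z+o_a+e_b+e_c$, $x+e_a+o_b+o_c$, $2y+z+o_a+e_b+e_c+|a-b|$, $z+e_a+o_b+o_c$. Let $\ell$ be the horizontal lattice line at level $y$ above the east vertex of $H$ if $a\le b$, and at level $y+a-b$ if $a>b$; $\ell\cap H$ is a segment of length $x+z+a+b+c$. Remove from $H$ three ferns along $\ell$: the left fern with side-lengths $a_1,\dots,a_m$ from left to right, $a_1$ down-pointing, starting at the left endpoint of $\ell\cap H$; the right fern with side-lengths $b_1,\dots,b_n$ read from right to left, $b_1$ up-pointing, ending at the right endpoint of $\ell\cap H$; and the middle fern with side-lengths $c_1,\dots,c_k$ from left to right, $c_1$ up-pointing, placed so that the distance along $\ell$ from the right end of the left fern to the left end of the middle fern and the distance from the right end of the middle fern to the left end of the right fern are both $\frac{x+z}{2}$. *)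

(* Defs.v *)
From HB Require Import structures.
From mathcomp Require Import all_boot all_order all_algebra finmap.

Set Implicit Arguments.
Unset Strict Implicit.
Unset Printing Implicit Defensive.

Local Open Scope fset_scope.
Local Open Scope nat_scope.

(* The pair (i, j) is the lattice point i * e1 + j * e2, where e1 is the unit
   vector pointing east and e2 the unit vector pointing in the northeast lattice
   direction (at 60 degrees from e1). Hence j is the level (number of rows), and
   the lattice lines are the lines on which i, j or i + j is constant. Every
   region below is positioned so that its points have coordinates in nat. *)
Definition point := (nat * nat)%type.

(* (i, j, true) is the up-pointing unit triangle whose left vertex is (i, j);
   (i, j, false) is the down-pointing one sharing its northeast edge. *)
Definition utriangle := (nat * nat * bool)%type.

Definition vertices (t : utriangle) : seq point :=
  let: (i, j, up) := t in
  if up then [:: (i, j); (i.+1, j); (i, j.+1)]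
  else [:: (i.+1, j); (i, j.+1); (i.+1, j.+1)].

Definition share_edge (t u : utriangle) : bool :=
  count (mem (vertices u)) (vertices t) == 2.

Definition region := {fset utriangle}.

Definition is_lozenge (R : region) (B : {set R}) : bool :=
  [exists t : R, exists u : R,
    share_edge (val t) (val u) && (B == [set t; u]%SET)].

Definition is_tiling (R : region) (P : {set {set R}}) : bool :=
  partition P [set: R] && [forall B in P, is_lozenge B].

Definition tilings (R : region) : {set {set {set R}}} :=
  [set P | is_tiling P].

Definition M (R : region) : nat := #|tilings R|.

(* The unit triangles of the parallelogram 0 <= i <= w, 0 <= j <= h. *)
Definition parallelogram (w h : nat) : region :=
  [fset t in [seq (p, up) | p <- [seq (i, j) | i <- iota 0 w, j <- iota 0 h],
                            up <- [:: true; false]]].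

(* The side-lengths are listed clockwise from the north side. The west vertex is
   (0, sSW); the others are (sSW, 0), (sSW + sS, 0), the east vertex
   (sSW + sS, sSE), (sN, sSW + sNW) and (0, sSW + sNW). Side-lengths that do not
   close up yield the empty region. *)
Definition hexagon (sN sNE sSE sS sSW sNW : nat) : region :=
  [fset t in parallelogram (sSW + sS) (sSW + sNW) |
    [&& sN + sNE == sS + sSW, sNE + sSE == sSW + sNW &
      all (fun p : point => sSW <= p.1 + p.2 <= sSW + sS + sSE) (vertices t)]].

(* Does the unit triangle t lie in the lattice triangle of side-length p whose
   horizontal side has left endpoint v, and which points up (down) if up is
   true (false)? *)
Definition in_triangle (up : bool) (v : point) (p : nat) (t : utriangle)
  : bool :=
  if up then
    all (fun q : point =>
      [&& v.1 <= q.1, v.2 <= q.2 & q.1 + q.2 <= v.1 + v.2 + p]) (vertices t)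
  else
    all (fun q : point =>
      [&& q.1 <= v.1 + p, q.2 <= v.2 & v.1 + v.2 <= q.1 + q.2]) (vertices t).

(* Sequences are indexed from 0, so that the mathematical t_i is nth 0 t (i - 1). *)
Definition osum (t : seq nat) : nat :=
  \sum_(i < size t | ~~ odd i) nth 0 t i.

Definition esum (t : seq nat) : nat :=
  \sum_(i < size t | odd i) nth 0 t i.

(* The fern with left end v and side-lengths t from left to right, its leftmost
   triangle pointing up iff up. *)
Definition in_fern (up : bool) (v : point) (t : seq nat) (u : utriangle)
  : bool :=
  has (fun i => in_triangle (up (+) odd i) (v.1 + sumn (take i t), v.2)
                  (nth 0 t i) u)
      (iota 0 (size t)).

(* The bottom side goes from (0, 0) to (osum t + esum t, 0). *)
Definition trapezoid (t : seq nat) : region :=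
  [fset u in parallelogram (osum t + esum t) (osum t) |
    all (fun p : point => p.1 + p.2 <= osum t + esum t) (vertices u)].

Definition dented_semihexagon (t : seq nat) : region :=
  [fset u in trapezoid t |
    ~~ has (fun i => ~~ odd i &&
              in_triangle true (sumn (take i t), 0) (nth 0 t i) u)
           (iota 0 (size t))].

Definition s (t : seq nat) : nat := M (dented_semihexagon t).

(* The hexagon with side-lengths X, Y, Z, X, Y, Z sharing the lines of the south,
   southwest and northwest sides of hexagon X (Y + p) Z (X + p) Y (Z + p) has
   west vertex (0, Y) and east vertex (X + Y, Z), so O has coordinates
   ((X + Y) / 2, (Y + Z) / 2). The unit steps west, northwest and southwest are
   (-1, 0), (-1, 1) and (0, -1); every halving below is exact. *)
Definition core_vertex (X Y Z : nat) : point :=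
  if (odd X == odd Y) && (odd Y == odd Z) then ((X + Y)./2, (Y + Z)./2)
  else if odd Y == odd Z then ((X + Y - 1)./2, (Y + Z)./2)
  else if odd X == odd Z then ((X + Y - 1)./2, (Y + Z + 1)./2)
  else ((X + Y)./2, (Y + Z - 1)./2).

Definition cored_hexagon (X Y Z p : nat) : region :=
  [fset t in hexagon X (Y + p) Z (X + p) Y (Z + p) |
    ~~ in_triangle true (core_vertex X Y Z) p t].

Definition absdiff (m n : nat) : nat := (m - n) + (n - m).

(* R^odot_{x,y,z}(a; c; b). The level of the east vertex is sSE, and the line at
   level l meets the hexagon between its southwest side i + j = sSW and its
   northeast side i + j = sSW + sS + sSE. The truncated subtraction a - b is 0
   when a <= b, and the other differences are never truncated. The right fern is
   read from right to left starting with an up-pointing triangle, so that its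
   leftmost triangle points up iff size b is odd. *)
Definition three_fern_region (x y z : nat) (a c b : seq nat) : region :=
  let sN  := x + osum a + esum b + esum c in
  let sNE := 2 * y + z + esum a + osum b + osum c + absdiff (sumn a) (sumn b) in
  let sSE := z + osum a + esum b + esum c in
  let sS  := x + esum a + osum b + osum c in
  let sSW := 2 * y + z + osum a + esum b + esum c + absdiff (sumn a) (sumn b) in
  let sNW := z + esum a + osum b + osum c in
  let l := sSE + (y + (sumn a - sumn b)) in
  let left_end := sSW - l in
  let right_end := sSW + sS + sSE - l in
  [fset t in hexagon sN sNE sSE sS sSW sNW |
    [&& ~~ in_fern false (left_end, l) a t,
        ~~ in_fern true (left_end + sumn a + (x + z)./2, l) c t &
        ~~ in_fern (odd (size b)) (right_end - sumn b, l) (rev b) t]].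

Definition hyperfactorial (n : nat) : nat := \prod_(i < n) i`!.

Definition H (n : nat) : rat := ((hyperfactorial n)%:R)%R.

Definition init_seq (t : seq nat) : seq nat := take (size t).-1 t.

(* Main.v *)
(* Cut the region along the line [l] of the ferns. A tiling is determined by the
   set [S] of the vertical lozenges crossing [l], which lies in the two gaps
   between the ferns and has [z] elements, and by tilings of the two halves with
   dents at [S]. After the forced lozenges are removed, each half is a trapezoid
   with unit dents on its long side, and the number of its tilings is the
   Vandermonde product of the positions of the dents divided by a hyperfactorial.
   Let [U] and [L] be the bases of the up- and down-pointing triangles, extended
   by the corner cut off on the left and on the right respectively. Then
   [vdm (U + S) * vdm (L + S) = vdm U * vdm L * w S], where [w] depends on the
   positions of the gaps only. Hence
   [M = vdm U * vdm L / (H (#|U| + z) * H (#|L| + z)) * Phi], where the sum [Phi]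
   of the [w S] is the same for all regions with the same gaps. The cored hexagon
   is one of them, and the dented semihexagons of the theorem count
   [vdm U / H #|U|] and [vdm L / H #|L|]. *)

Require Import Defs.
From HB Require Import structures.
From mathcomp Require Import all_boot all_order all_algebra finmap.
From mathcomp Require Import zify ring.

Set Implicit Arguments.
Unset Strict Implicit.
Unset Printing Implicit Defensive.

Import GRing.Theory Num.Theory.

Local Open Scope nat_scope.

#[local] Arguments in_triangle : simpl never.

(** * Counting tilings by expansion along a triangle *)

(** The weight [w] forgets [U] and [L] because a position outside the gaps lies in exactly one of
    them: its differences with elements of [S] occur once in the product of the two Vandermonde
    products, while differences inside [S] occur twice. The size of [S] comes from a count: a
    trapezoid with [N] rows and unit dents needs [N] dents to be tileable, and each half has [z]
    rows more than dents outside [S]. [Phi] is never evaluated; it is eliminated between the region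
    and a cored hexagon with the same line length and the same gaps, which dictates the parameter
    [2 * Y + z] with [Y] equal to [y] plus the larger of [a] and [b]. The Vandermonde formula for
    one trapezoid is proved row by row: the vertical lozenges leaving a row interlace with the dents
    below, and a Vandermonde determinant is easily summed over interlacing sequences in the basis of
    falling factorials. Tilings of different regions live in different types; once the expansion
    over the partners of one triangle is available, no bijection between sets of tilings is built:
    transport, forced lozenges and the cut all follow from it. *)

Section PairTilings.
Variables (T : finType) (adj : rel T).
Hypotheses (adj_sym : symmetric adj) (adj_irr : irreflexive adj).

Definition is_pair (B : {set T}) : bool :=
  [exists t, exists u, adj t u && (B == [set t; u])].

(** Perfect matchings of the part [A] of a fixed graph: with [T] fixed, deleting vertices does not
    change the type of a matching, as it would for tilings of a region. *)
Definition pair_tilings (A : {set T}) : {set {set {set T}}} :=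
  [set P | partition P A && [forall B in P, is_pair B]].

Lemma pair_tilings_set0 : #|pair_tilings set0| = 1.
Proof.
rewrite (_ : pair_tilings set0 = [set set0]) ?cards1 //.
apply/setP => P; rewrite !inE partition_set0.
case: eqP => // -> /=; apply/forallP => B; by rewrite inE.
Qed.

Lemma pair_tiling_pairP (P : {set {set T}}) A t :
  P \in pair_tilings A -> t \in A ->
  exists2 u, [/\ u \in A, adj t u & [set t; u] \in P] &
    forall v, [set t; v] \in P -> v = u.
Proof.
rewrite inE => /andP[partP /forallP pairP] tA.
have covP := cover_partition partP.
have trivP := partition_trivIset partP.
have tcov : t \in cover P by rewrite covP.
have BP := pblock_mem tcov; have tB : t \in pblock P t by rewrite mem_pblock.
have pairs C : C \in P -> t \in C -> exists2 u, adj t u & C = [set t; u].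
  move=> CP tC; move: (pairP C); rewrite CP /=.
  case/existsP=> t' /existsP[u' /andP[adj' /eqP CE]].
  move: tC; rewrite CE !inE => /orP[] /eqP ->; first by exists u'.
  by exists t'; rewrite 1?adj_sym // setUC.
have [u adju BE] := pairs _ BP tB.
exists u; first split=> //.
- rewrite -covP; apply/bigcupP; exists (pblock P t) => //.
  by rewrite BE !inE eqxx orbT.
- by rewrite -BE.
- move=> v vP.
  (* The block of [t] is unique, so [v] is [u] or [t]; the latter would make the block a singleton,
     which irreflexivity forbids. *)
  have := def_pblock trivP vP; move/(_ t); rewrite !inE eqxx /= => /(_ isT).
  rewrite BE => /setP eqs.
  have := eqs v; rewrite !inE eqxx orbT => /orP[] /eqP; last by [].
  move=> vt; have [w adjw] := pairs _ vP (set21 _ _); rewrite vt => /setP/(_ w).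
  rewrite !inE eqxx orbT orbb => /eqP wt; by rewrite wt adj_irr in adjw.
Qed.

Lemma card_pair_tilings_with (A : {set T}) t u :
  t \in A -> u \in A -> adj t u ->
  #|[set P in pair_tilings A | [set t; u] \in P]| =
  #|pair_tilings (A :\ t :\ u)|.
Proof.
move=> tA uA adjtu.
have AE : A :\ t :\ u = A :\: [set t; u] by rewrite setDDl.
have nin P : P \in pair_tilings (A :\ t :\ u) -> [set t; u] \notin P.
  rewrite inE => /andP[partP _]; apply/negP => inP.
  have : t \in cover P by apply/bigcupP; exists [set t; u]; rewrite ?set21.
  by rewrite (cover_partition partP) !inE eqxx andbF.
rewrite -[RHS](card_in_imset (f := fun P => [set t; u] |: P)); last first.
  move=> P Q inP inQ eqPQ.
  by rewrite -(setU1K (nin _ inP)) eqPQ (setU1K (nin _ inQ)).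
apply: eq_card => P; apply/idP/imsetP.
- rewrite inE => /andP[]; rewrite inE => /andP[partP /forallP pairP] inP.
  exists (P :\ [set t; u]); last by rewrite setD1K.
  rewrite inE AE partitionD1 //=; apply/forallP=> B; apply/implyP.
  by rewrite inE => /andP[_ BP]; move: (pairP B); rewrite BP.
- case=> Q inQ ->; rewrite !inE eqxx /= andbT.
  move: inQ; rewrite inE => /andP[partQ /forallP pairQ].
  apply/andP; split.
    have -> : A = [set t; u] :|: (A :\ t :\ u).
      rewrite AE setDE setUIr setUCr setIT; apply/esym/setUidPr.
      by rewrite subUset !sub1set tA uA.
    apply: partitionU1 => //; first by apply/set0Pn; exists t; rewrite set21.
    by rewrite AE -setI_eq0 setIDA setIC -setIDA setDv setI0.
  apply/forallP => B; rewrite !inE; apply/implyP => /orP[/eqP ->|BQ].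
    by apply/existsP; exists t; apply/existsP; exists u; rewrite adjtu eqxx.
  by move: (pairQ B); rewrite BQ.
Qed.

(** Double counting: every tiling gives [t] exactly one partner, so after exchanging the sums each
    tiling contributes 1. *)
Lemma pair_tilings_expand (A : {set T}) t : t \in A ->
  #|pair_tilings A| = \sum_(u in A | adj t u) #|pair_tilings (A :\ t :\ u)|.
Proof.
move=> tA; transitivity (\sum_(u in A | adj t u)
    #|[set P in pair_tilings A | [set t; u] \in P]|); last first.
  by apply: eq_bigr => u /andP[uA adju]; rewrite card_pair_tilings_with.
rewrite -sum1_card.
under [RHS]eq_bigr do rewrite -sum1_card.
under [RHS]eq_bigr => u _.
  rewrite (eq_bigl (fun P => (P \in pair_tilings A) && ([set t; u] \in P)));
    last by move=> P; rewrite inE.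
  rewrite big_mkcondr /=. over.
rewrite exchange_big /=; apply: eq_bigr => P inP.
have [u [uA adju uP] uniqu] := pair_tiling_pairP inP tA.
rewrite (bigD1 u) ?uA //= uP big1 // => v /andP[_ vu].
by case: ifP => // /uniqu vE; rewrite vE eqxx in vu.
Qed.

End PairTilings.

(** Induction on [#|A|], expanding along [t] on one side and along [f t] on the other; this avoids
    pushing sets of sets of sets through [f]. *)
Lemma card_pair_tilings_transport (T T' : finType) (adj : rel T)
    (adj' : rel T') (f : T -> T') (A : {set T}) :
  symmetric adj -> irreflexive adj -> symmetric adj' -> irreflexive adj' ->
  {in A &, injective f} -> {in A &, forall x y, adj' (f x) (f y) = adj x y} ->
  #|pair_tilings adj A| = #|pair_tilings adj' (f @: A)|.
Proof.
move=> sa ia sa' ia'; have [n] := ubnP #|A|; elim: n A => // n IHn A ltA injf adjf.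
case: (set_0Vmem A) => [->|[t tA]]; first by rewrite imset0 !pair_tilings_set0.
rewrite (pair_tilings_expand sa ia tA).
rewrite (pair_tilings_expand sa' ia' (imset_f f tA)).
rewrite big_mkcondr [RHS]big_mkcondr /= big_imset //=; apply: eq_bigr => u uA.
rewrite adjf //; case: ifP => // adju.
have subA : A :\ t :\ u \subset A by rewrite setDDl subsetDl.
have -> : (f @: A) :\ f t :\ f u = f @: (A :\ t :\ u).
  apply/setP=> v; rewrite !inE; apply/and3P/imsetP.
    case=> vu vt /imsetP[w wA vE]; exists w => //; rewrite !inE wA andbT.
    by apply/andP; split; apply/eqP => wE; rewrite vE wE eqxx in vu vt.
  case=> w; rewrite !inE => /and3P[wu wt wA] ->.
  by rewrite imset_f // !(inj_in_eq injf) // wu wt.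
apply: IHn; first last.
- by move=> x y /(subsetP subA) xA /(subsetP subA) yA; apply: adjf.
- by move=> x y /(subsetP subA) xA /(subsetP subA) yA; apply: injf.
- rewrite -ltnS (leq_trans _ ltA) // ltnS; apply: proper_card.
  by apply/properP; split=> //; exists t => //; rewrite !inE eqxx andbF.
Qed.

(** * Regions as graphs of unit triangles *)

Definition neighbours (t u : utriangle) : bool :=
  let: (i, j, b) := t in let: (k, l, d) := u in
  match b, d with
  | false, true => [|| (i == k) && (j == l), (i.+1 == k) && (j == l) |
                       (i == k) && (j.+1 == l)]
  | true, false => [|| (i == k) && (j == l), (i == k.+1) && (j == l) |
                       (i == k) && (j == l.+1)]
  | _, _ => false
  end.

Lemma share_edgeE : share_edge =2 neighbours.
Proof.
(* Shifted equalities exclude one another; with these facts the count of common vertices is decided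
   by boolean cases alone. *)
have excl (m n : nat) : [&& ~~ ((m == n) && (m.+1 == n)),
    ~~ ((m == n) && (m == n.+1)) & ~~ ((m.+1 == n) && (m == n.+1))] by lia.
move=> [[i j] [|]] [[k l] [|]]; rewrite /share_edge /= !inE !xpair_eqE ?eqSS;
  move: (excl i k) (excl j l);
  by case: (i == k); case: (i.+1 == k); case: (i == k.+1);
     case: (j == l); case: (j.+1 == l); case: (j == l.+1).
Qed.

Lemma neighbours_sym : symmetric neighbours.
Proof.
by move=> [[i j] [|]] [[k l] [|]] //=; rewrite (eq_sym i) (eq_sym j)
  ?(eq_sym i.+1) ?(eq_sym j.+1) ?(eq_sym i) ?(eq_sym j).
Qed.

Lemma neighbours_irr : irreflexive neighbours.
Proof. by move=> [[i j] [|]]. Qed.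

Definition neighbours_in (R : region) : rel R :=
  fun t u => neighbours (val t) (val u).

Lemma M_pair_tilings (R : region) :
  M R = #|pair_tilings (neighbours_in (R := R)) setT|.
Proof.
apply: eq_card => P; rewrite !inE /is_tiling; congr andb.
apply: eq_forallb => B; congr (_ ==> _).
rewrite /is_lozenge /is_pair; apply: eq_existsb => t.
by apply: eq_existsb => u; rewrite share_edgeE.
Qed.

Lemma neighbours_in_sym (R : region) : symmetric (neighbours_in (R := R)).
Proof. by move=> t u; apply: neighbours_sym. Qed.

Lemma neighbours_in_irr (R : region) : irreflexive (neighbours_in (R := R)).
Proof. by move=> t; apply: neighbours_irr. Qed.

Lemma M_fset0 : M fset0 = 1.
Proof.
rewrite M_pair_tilings (_ : setT = set0) ?pair_tilings_set0 //.
by apply/setP=> -[].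
Qed.

(** Deleting triangles changes the type in which tilings live; the inclusion [fincl] carries the
    smaller region back into [R]. *)
Lemma M_expand (R : region) t : t \in R ->
  M R = \sum_(u <- R | neighbours t u) M (R `\ t `\ u)%fset.
Proof.
move=> tR; rewrite M_pair_tilings (@pair_tilings_expand _ _
  (@neighbours_in_sym R) (@neighbours_in_irr R) _ [` tR]%fset) //.
rewrite big_seq_fsetE /=; apply: eq_big => [u|u]; first by rewrite inE.
move=> _; rewrite M_pair_tilings; set R' := (R `\ t `\ val u)%fset.
have sR' : (R' `<=` R)%fset by rewrite /R' fsetDDl fsubsetDl.
rewrite [RHS](@card_pair_tilings_transport _ _ _ _ (fincl sR') _
  (@neighbours_in_sym _) (@neighbours_in_irr _)
  (@neighbours_in_sym R) (@neighbours_in_irr R)) //.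
  congr #|pair_tilings _ _|; apply/setP => v; rewrite !inE andbT.
  apply/andP/imsetP => [[vu vt]|[w _ ->]].
    have vR' : val v \in R'.
      rewrite -!(inj_eq val_inj) /= in vu vt.
      by rewrite !inE (valP v) vu vt.
    by exists [` vR']%fset => //; apply: val_inj.
  by have := valP w; rewrite !inE => /and3P[wu wt _]; rewrite -!(inj_eq val_inj) /=.
by move=> v w _ _ /(congr1 val) /= vw; apply: val_inj.
Qed.

(** The conditions on [f] and [g] are restricted to the regions because the translations and
    reflections used later involve truncated subtraction. *)
Lemma M_transport (R R' : region) (f g : utriangle -> utriangle) :
  {in R, forall t, f t \in R'} -> {in R', forall t, g t \in R} ->
  {in R, cancel f g} -> {in R', cancel g f} ->
  {in R &, forall t u, neighbours (f t) (f u) = neighbours t u} ->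
  M R = M R'.
Proof.
move=> fR gR fK gK adjf; pose f' (t : R) : R' := [` fR _ (valP t)]%fset.
rewrite !M_pair_tilings.
rewrite (@card_pair_tilings_transport _ _ _ _ f' _
  (@neighbours_in_sym _) (@neighbours_in_irr _)
  (@neighbours_in_sym R') (@neighbours_in_irr R')).
- congr #|pair_tilings _ _|; apply/setP => u; rewrite inE; apply/imsetP.
  by exists [` gR _ (valP u)]%fset => //; apply: val_inj; rewrite /= gK ?(valP u).
- move=> t u _ _ /(congr1 val) /= eqf; apply: val_inj.
  by rewrite -(fK _ (valP t)) eqf fK ?(valP u).
- by move=> t u _ _; rewrite /neighbours_in /= adjf ?(valP t) ?(valP u).
Qed.

(** * Cutting a region along a horizontal line *)

Lemma M_isolated (R : region) t : t \in R ->
  (forall u, u \in R -> ~~ neighbours t u) -> M R = 0.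
Proof.
move=> tR iso; rewrite (M_expand tR) big_seq_cond big1 // => u /andP[uR].
by rewrite (negPf (iso u uR)).
Qed.

Lemma M_forced (R : region) t u : t \in R -> u \in R -> neighbours t u ->
  (forall v, v \in R -> neighbours t v -> v = u) -> M R = M (R `\ t `\ u)%fset.
Proof.
move=> tR uR tu only; rewrite (M_expand tR) big_mkcond (big_fsetD1 u) //= tu.
rewrite big_seq big1 ?addn0 // => v; rewrite !inE => /andP[vu vR].
by case: ifP => // /(only _ vR) vE; rewrite vE eqxx in vu.
Qed.

Definition nat_in n (S : {set 'I_n}) (k : nat) : bool :=
  [exists i in S, val i == k].

Lemma nat_in_ord n (S : {set 'I_n}) (i : 'I_n) : nat_in S i = (i \in S).
Proof.
apply/existsP/idP => [[j /andP[jS /eqP/val_inj <-]] //|iS].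
by exists i; rewrite iS eqxx.
Qed.

Lemma nat_in_lt n (S : {set 'I_n}) k : nat_in S k -> k < n.
Proof. by case/existsP=> i /andP[_ /eqP <-]; apply: ltn_ord. Qed.

Lemma nat_in0 n k : nat_in (set0 : {set 'I_n}) k = false.
Proof. by apply/existsP => -[i]; rewrite inE. Qed.

Lemma nat_inU1 n (S : {set 'I_n}) i k :
  nat_in (i |: S) k = (k == i) || nat_in S k.
Proof.
apply/existsP/orP => [[j]|[/eqP ->|/existsP[j /andP[jS jk]]]].
- rewrite !inE => /andP[/orP[/eqP ->|jS] /eqP <-]; first by left.
  by right; rewrite nat_in_ord.
- by exists i; rewrite !inE !eqxx.
- by exists j; rewrite !inE jS orbT.
Qed.

Definition level (t : utriangle) : nat := t.1.2.

Definition crossing (R : region) (l i : nat) : bool :=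
  [&& 0 < l, (i, l.-1, false) \in R & (i, l, true) \in R].

Definition crossed_down (l : nat) (S : pred nat) (t : utriangle) : bool :=
  [&& ~~ t.2, (level t).+1 == l & S t.1.1].

Definition crossed_up (l : nat) (S : pred nat) (t : utriangle) : bool :=
  [&& t.2, level t == l & S t.1.1].

Definition lower_part (R : region) (l : nat) (S : pred nat) : region :=
  [fset t in R | (level t < l) && ~~ crossed_down l S t]%fset.

Definition upper_part (R : region) (l : nat) (S : pred nat) : region :=
  [fset t in R | (l <= level t) && ~~ crossed_up l S t]%fset.

(** The value 0 for sets [S] whose vertical lozenges do not fit in [R] lets the cut formula range
    over all subsets. *)
Definition cut_term n (R : region) (l : nat) (S : {set 'I_n}) : nat :=
  if [forall i in S, crossing R l i] then
    M (lower_part R l (nat_in S)) * M (upper_part R l (nat_in S)) else 0.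

Lemma M_cut_base n (R : region) l : (forall t, t \in R -> l <= level t) ->
  M R = \sum_(S : {set 'I_n}) cut_term R l S.
Proof.
move=> up; rewrite (bigD1 set0) //= big1 ?addn0 => [|S /set0Pn[i iS]].
  rewrite /cut_term; case: ifP => [_|/forallP[]]; last by move=> i; rewrite inE.
  rewrite (_ : lower_part _ _ _ = fset0) ?M_fset0 ?mul1n; last first.
    apply/fsetP=> t; rewrite !inE /=; case tR: (t \in R) => //=.
    by rewrite ltnNge up.
  congr M; apply/fsetP=> t; rewrite !inE /crossed_up nat_in0 !andbF andbT.
  by case tR: (t \in R) => //=; rewrite up.
rewrite /cut_term; case: ifP => // /forallP/(_ i); rewrite iS /=.
by case/and3P=> l0 /up; rewrite /level /=; lia.
Qed.

(** All partners of an up-pointing triangle below the line are below it too, so expanding [R] along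
    [t] amounts to expanding every lower part along [t], with the upper parts untouched. *)
Lemma M_cut_up n (R : region) l t :
  t \in R -> t.2 -> level t < l ->
  (forall u, u \in R -> neighbours t u -> M (R `\ t `\ u)%fset =
     \sum_(S : {set 'I_n}) cut_term (R `\ t `\ u)%fset l S) ->
  M R = \sum_(S : {set 'I_n}) cut_term R l S.
Proof.
move=> tR tup tl IH; rewrite (M_expand tR) big_seq_cond.
under eq_bigr => u /andP[uR tu] do rewrite IH //.
rewrite -big_seq_cond exchange_big /=; apply: eq_bigr => S _.
have nb u : neighbours t u -> ~~ u.2 /\ level u <= level t.
  move: t u tup {tR tl IH} => [[i j] [|]] [[k m] [|]] //= _; rewrite /level /=; lia.
have crossW u i : crossing (R `\ t `\ u)%fset l i -> crossing R l i.
  by case/and3P=> l0; rewrite !inE /crossing => /and3P[_ _ ->] /and3P[_ _ ->]; rewrite l0.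
rewrite {2}/cut_term; case: ifP => cr; last first.
  rewrite big1 // => u tu; rewrite /cut_term; case: ifP => //.
  move=> /forallP cr'; case/forallP: cr => i; move: (cr' i).
  by case: (i \in S) => //=; apply: crossW.
have tlow : t \in lower_part R l (nat_in S).
  by rewrite !inE tR tl /crossed_down tup.
have -> : M (lower_part R l (nat_in S)) =
    \sum_(u <- R | neighbours t u && (u \in lower_part R l (nat_in S)))
      M (lower_part R l (nat_in S) `\ t `\ u)%fset.
  rewrite (M_expand tlow) [LHS]big_mkcond {1}/lower_part -[LHS]big_fset_condE.
  rewrite -[LHS]big_mkcondr [LHS]big_seq_cond [RHS]big_seq_cond /=.
  apply: eq_bigl => u; rewrite !inE /=.
  by case: (u \in R) => //=; rewrite andbC.
rewrite big_distrl /=.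
rewrite [LHS](bigID (mem (lower_part R l (nat_in S)))) /= addnC big_seq_cond big1 ?add0n.
  rewrite [LHS]big_seq_cond [RHS]big_seq_cond.
  apply: eq_bigr => u; case/and3P=> uR tu; rewrite !inE /= uR /= => /andP[ul ucr].
  have [ud _] := nb _ tu.
  rewrite /cut_term ifT.
    congr (M _ * M _); apply/fsetP=> v; rewrite !inE.
      by rewrite -!andbA; do !bool_congr.
    case: (v \in R) => /=; last by rewrite !andbF.
    case: (ltnP (level v) l) => //= lv.
    rewrite !andbF //.
    case: eqP => [vu|_] /=; first by move: lv; rewrite vu; lia.
    by case: eqP => [vt|//] /=; move: lv; rewrite vt; lia.
  apply/forallP => i; apply/implyP=> iS.
  move/forallP: cr => /(_ i); rewrite iS /= => /and3P[l0 dR uR'].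
  rewrite /crossing l0 !inE dR uR' !andbT /=; apply/and3P; split.
  - apply/andP; split; last by apply/eqP => tE; rewrite -tE in tup.
    apply: contra ucr => /eqP <-; rewrite /crossed_down /level /= prednK // eqxx.
    by rewrite nat_in_ord.
  - by apply/eqP=> uE; rewrite -uE in ud.
  - by apply/eqP=> tE; move: tl; rewrite -tE /level /= ltnn.
(* A partner [u] missing from the lower part is the lower half of a lozenge of [S]; once [u] is
   deleted that lozenge no longer fits and the term is 0. *)
move=> u /and3P[uR tu]; rewrite !inE uR /=; have [ud ut] := nb _ tu.
rewrite (leq_ltn_trans ut tl) /= negbK => /and3P[_ /eqP ul uS].
rewrite /cut_term; case: ifP => // /forallP/(_ (Ordinal (nat_in_lt uS))).
rewrite -nat_in_ord /= uS /= => /and3P[_].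
move: ul ud; rewrite /level; case: (u) => [[i j] [|]] //= <- _ /=.
by rewrite !inE eqxx.
Qed.

(** With no up-pointing triangle left below the line, [t] can only be matched across it: either its
    vertical lozenge crosses the line inside [R] and is forced, or both sides are 0. *)
Lemma M_cut_down n (R : region) l t :
  (forall u, u \in R -> u.1.1 < n) ->
  t \in R -> ~~ t.2 -> level t < l ->
  (forall u, u \in R -> u.2 -> l <= level u) ->
  (forall u, u \in R -> neighbours t u -> M (R `\ t `\ u)%fset =
     \sum_(S : {set 'I_n}) cut_term (R `\ t `\ u)%fset l S) ->
  M R = \sum_(S : {set 'I_n}) cut_term R l S.
Proof.
move: t => [[i j] [|]] // bnd tR _ tl noup IH.
have nb u : u \in R -> neighbours (i, j, false) u -> u = (i, l, true) /\ l = j.+1.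
  move=> uR; have := noup u uR; move: u {uR} tl => [[k m] [|]] //.
  rewrite /level /= => tl /(_ isT) lm nbu.
  by have [-> -> ->] : [/\ k = i, m = l & l = j.+1] by split; lia.
have [uR|uR] := boolP (((i, l, true) \in R) && (l == j.+1)); last first.
  rewrite (M_isolated tR) => [|u uR']; last first.
    apply: contra uR => tu; have [uE lE] := nb _ uR' tu.
    by rewrite -uE uR' lE eqxx.
  rewrite big1 // => S _; rewrite /cut_term; case: ifP => // /forallP cr.
  rewrite (@M_isolated (lower_part R l (nat_in S)) (i, j, false)) ?mul0n //.
    rewrite !inE tR tl /=; apply/negP => /and3P[_ /eqP lE iS].
    have := cr (Ordinal (nat_in_lt iS)); rewrite -nat_in_ord /= iS /=.
    by case/and3P=> _ _ uR'; rewrite uR' -lE eqxx in uR.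
  move=> u; rewrite !inE => /andP[uR' _]; apply: contra uR => tu.
  by have [uE lE] := nb _ uR' tu; rewrite -uE uR' lE eqxx.
case/andP: uR => uR /eqP lE.
have tu : neighbours (i, j, false) (i, l, true) by rewrite /= lE !eqxx !orbT.
rewrite (M_forced tR uR tu) => [|v vR /(nb _ vR)[] //].
rewrite IH //; set R' := (R `\ _ `\ _)%fset.
have ltin : i < n by apply: (bnd _ tR).
pose o := Ordinal ltin.
rewrite [RHS](bigID (fun S : {set 'I_n} => o \in S)) /= addnC.
rewrite [X in _ = X + _]big1 ?add0n; last first.
  move=> S oS; rewrite /cut_term; case: ifP => // _.
  rewrite (@M_isolated (lower_part R l (nat_in S)) (i, j, false)) ?mul0n //.
    rewrite !inE tR tl /=; apply/negP => /and3P[_ _].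
    by rewrite (nat_in_ord S o) (negPf oS).
  move=> u; rewrite !inE => /andP[uR' /andP[ul _]]; apply/negP=> tu'.
  by have [uE _] := nb _ uR' tu'; move: ul; rewrite uE /level /= ltnn.
rewrite (bigID (fun S : {set 'I_n} => o \in S)) /= big1 ?add0n; last first.
  move=> S oS; rewrite /cut_term; case: ifP => // /forallP/(_ o).
  by rewrite oS /= => /and3P[_]; rewrite lE /= !inE eqxx andbF.
(* Sets containing [o] correspond to sets avoiding it, since [R'] has already lost the lozenge at
   [o]. *)
rewrite [RHS](reindex_onto (fun S => o |: S) (fun S => S :\ o)) /=; last first.
  by move=> S oS; rewrite setD1K.
apply: eq_big => [S|S oS].
  rewrite setU11 /=; apply/idP/eqP => [oS|<-]; last by rewrite !inE eqxx.
  by rewrite setU1K.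
rewrite /cut_term.
have -> : [forall k in S, crossing R' l k] = [forall k in o |: S, crossing R l k].
  apply/forallP/forallP => cr k; have := cr k.
    rewrite !inE; case: eqP => [-> _|_] /=.
      by rewrite /crossing lE /= tR -lE uR.
    case: (k \in S) => //=; rewrite /crossing !inE => /and3P[-> /and3P[_ _ ->]].
    by case/and3P=> _ _ ->.
  rewrite !inE; case: eqP => [->|/eqP ko] /=; first by rewrite (negPf oS).
  case: (k \in S) => //= /and3P[l0 dR uR'].
  rewrite /crossing l0 !inE dR uR' !andbT /= !xpair_eqE /= !andbF /=.
  by rewrite (_ : (val k == i) = false) //; apply/negbTE.
case: ifP => // _; congr (M _ * M _); apply/fsetP=> v; rewrite !inE.
  rewrite /crossed_down nat_inU1.
  case: (v \in R); rewrite ?andbF //= ?andbT.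
  case: v => [[k m] [|]]; rewrite /level /= !xpair_eqE /= ?andbF //= ?andbT.
    by case: (ltnP m l) => ml; rewrite ?andbF //; case: eqP => //; lia.
  rewrite lE eqSS ltnS; case: (eqVneq m j) => [->|mj]; rewrite ?andbF //= ?andbT.
  by case: eqP => //=; rewrite ?andbF.
rewrite /crossed_up nat_inU1.
case: (v \in R); rewrite ?andbF //= ?andbT.
case: v => [[k m] [|]]; rewrite /level /= !xpair_eqE /= ?andbF //= ?andbT.
  case: (eqVneq m l) => [->|mj]; rewrite ?andbF //= ?andbT.
  by case: eqP => //=; rewrite ?andbF.
case: (ltnP m l) => ml; rewrite ?andbF //.
by case: (eqVneq m j) => [mj|]; rewrite ?andbF //; move: ml; rewrite mj; lia.
Qed.

(* Expand along up-pointing triangles below the line as long as there are any;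
   the remaining down-pointing ones are then forced to cross it. *)
Theorem M_cut n (R : region) l : (forall u, u \in R -> u.1.1 < n) ->
  M R = \sum_(S : {set 'I_n}) cut_term R l S.
Proof.
have [m] := ubnP #|`R|%fset; elim: m R => // m IHm R ltR bnd.
have IH t u : t \in R -> M (R `\ t `\ u)%fset =
    \sum_(S : {set 'I_n}) cut_term (R `\ t `\ u)%fset l S.
  move=> tR; apply: IHm => [|v]; last by rewrite !inE => /and3P[_ _ /bnd].
  move: ltR; rewrite (cardfsD1 t) tR add1n !ltnS; apply: leq_trans.
  by rewrite ltnS; apply: fsubset_leq_card; apply: fsubsetDl.
have [/hasP[t tR /andP[tup tl]]|/hasPn noup] :=
  boolP (has (fun t => t.2 && (level t < l)) R).
  by apply: (M_cut_up tR tup tl) => u _ _; exact: IH.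
have up u : u \in R -> u.2 -> l <= level u.
  by move=> uR uup; have := noup u uR; rewrite uup -leqNgt.
have [/hasP[t tR tl]|/hasPn nolow] := boolP (has (fun t => level t < l) R).
  have td : ~~ t.2 by apply: contraL tl => /(up _ tR); rewrite -leqNgt.
  by apply: (M_cut_down bnd tR td tl up) => u _ _; exact: IH.
by apply: M_cut_base => t /nolow; rewrite -leqNgt.
Qed.

(** * Vandermonde products and interlacing sequences *)

Fixpoint vdm (s : seq nat) : rat :=
  if s is x :: r then ((\prod_(y <- r) (y%:R - x%:R)) * vdm r)%R else 1%R.

(* The sum of [G (sigma ++ tau)] over the sequences [tau] that interlace with
   [k :: d]. *)
Fixpoint interlacing_sum (G : seq nat -> rat) (sigma : seq nat) (k : nat)
    (d : seq nat) : rat :=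
  if d is d1 :: d' then
    (\sum_(k <= s < d1) interlacing_sum G (rcons sigma s) d1 d')%R
  else G sigma.

Section Determinants.
Local Open Scope ring_scope.

(** Rows are functions kept in a list, so that a single row can be replaced by a sum. *)
Definition det_rows (n : nat) (L : seq (nat -> rat)) : rat :=
  \det (\matrix_(i < n, j < n) nth (fun=> 0) L i j).

Lemma det_rows_sum n (p q : seq (nat -> rat)) (r : seq nat)
    (f : nat -> nat -> rat) (g : nat -> rat) :
  (size p < n)%N -> (forall j, g j = \sum_(i <- r) f i j) ->
  det_rows n (p ++ g :: q) = \sum_(i <- r) det_rows n (p ++ f i :: q).
Proof.
move=> ltp gE; pose i0 := Ordinal ltp.
have nthi0 h j : nth (fun=> 0) (p ++ h :: q) i0 j = h j :> rat.
  by rewrite nth_cat /= ltnn subnn.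
rewrite {1}/det_rows (expand_det_row _ i0).
under [RHS]eq_bigr do rewrite /det_rows (expand_det_row _ i0).
rewrite exchange_big /=; apply: eq_bigr => j _.
rewrite mxE nthi0 gE mulr_suml; apply: eq_bigr => i _.
rewrite mxE nthi0; congr (_ * _); rewrite /cofactor; congr (_ * \det _).
apply/matrixP => u v; rewrite !mxE !nth_cat.
have : lift i0 u != i0 by rewrite eq_sym neq_lift.
rewrite -val_eqE; set w := val (lift i0 u) => /=.
case: ltngtP => //= wp _; case E: (w - size p)%N => [|m] //.
by move/eqP: E; rewrite subn_eq0 leqNgt wp.
Qed.

Definition ffact_row (x j : nat) : rat := (x ^_ j)%:R.

(** From [x] to [x.+1], the falling factorial [x ^_ j.+1] grows by [j.+1 * x ^_ j], so the sum
    telescopes. This is why falling factorials replace powers. *)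
Lemma sum_ffact_row k d j : (k <= d)%N ->
  \sum_(k <= s < d) ffact_row s j =
  (ffact_row d j.+1 - ffact_row k j.+1) / j.+1%:R.
Proof.
move=> kd; rewrite -(telescope_sumr (fun s => ffact_row s j.+1) kd) mulr_suml.
apply: eq_bigr => s _; rewrite /ffact_row ffactSS ffactnSr.
apply: canRL (mulfK _) _; first by rewrite pnatr_eq0.
have [sj|sj] := ltnP s j; first by rewrite ffact_small // muln0 mul0n !mulr0n mul0r subr0.
rewrite [(s.+1 * _)%N]mulnC -natrB; last by apply: leq_mul => //; lia.
by rewrite -mulnBr -natrM; congr (_ * _)%:R; lia.
Qed.

Definition ffact_diff (a b j : nat) : rat :=
  (ffact_row b j.+1 - ffact_row a j.+1) / j.+1%:R.

(** Each summation variable occurs in a single row, so multilinearity sums the rows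
    independently. *)
Lemma interlacing_sum_det n sigma k d : path ltn k d ->
  (size sigma + size d = n)%N ->
  interlacing_sum (fun s => det_rows n (map ffact_row s)) sigma k d =
  det_rows n (map ffact_row sigma ++ pairmap ffact_diff k d).
Proof.
elim: d sigma k => [|d1 d IHd] sigma k /=; first by rewrite cats0.
case/andP=> kd1 pd sz.
rewrite (@det_rows_sum _ _ _ (index_iota k d1) ffact_row) ?size_map; first last.
- by move=> j; rewrite sum_ffact_row // ltnW.
- by lia.
apply: eq_bigr => s _; rewrite IHd //; last by rewrite size_rcons; lia.
by rewrite map_rcons cat_rcons.
Qed.

(** Falling factorials are monic polynomials, hence related to the powers by a unitriangular matrix,
    the [C] below. *)
Lemma det_rows_ffact n s : size s = n ->
  det_rows n (map ffact_row s) = vdm s.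
Proof.
move=> sz; pose a : 'rV[rat]_n := \row_i (nth 0%N s i)%:R.
pose P j : {poly rat} := \prod_(0 <= i < j) ('X - (i%:R)%:P).
have sP j : size (P j) = j.+1.
  by rewrite /P size_prod_XsubC size_iota subn0.
have P_eval j (x : nat) : (P j).[x%:R] = (x ^_ j)%:R.
  rewrite /P horner_prod; elim: j => [|j IHj]; first by rewrite big_nil.
  rewrite big_nat_recr //= IHj hornerXsubC ffactnSr natrM.
  have [xj|xj] := ltnP x j; first by rewrite ffact_small // !mul0r.
  by rewrite natrB.
pose C : 'M[rat]_n := \matrix_(m, j) (P j)`_m.
have detC : \det C = 1.
  rewrite -det_tr det_trig; last first.
    apply/is_trig_mxP => i j ij; rewrite !mxE nth_default // sP //.
  apply: big1 => i _; rewrite !mxE.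
  have := monic_prod_XsubC (index_iota 0 i) xpredT (fun k => (k%:R : rat)).
  by rewrite monicE lead_coefE -/(P i) sP /= => /eqP.
transitivity (\det ((Vandermonde n a)^T *m C)).
  congr (\det _); apply/matrixP=> i j; rewrite !mxE.
  rewrite (nth_map 0%N) ?sz // /ffact_row -P_eval (@horner_coef_wide _ n) ?sP //.
  by apply: eq_bigr => m _; rewrite !mxE mulrC.
rewrite det_mulmx detC mulr1 det_tr det_Vandermonde {P sP P_eval C detC}.
under eq_bigr do under eq_bigr do rewrite !mxE.
subst n; rewrite {a}; elim: s => [|x s IHs]; first by rewrite big_ord0.
rewrite big_ord_recl /= -IHs; congr (_ * _).
  rewrite (big_nth 0%N) big_mkord big_mkcond big_ord_recl /= mul1r.
  by apply: eq_bigr => i _; rewrite /=.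
apply: eq_bigr => i _; rewrite big_mkcond big_ord_recl /= mul1r.
by rewrite -big_mkcond /=.
Qed.

(** In the matrix of [k :: d], subtracting from each row the one before it reduces the constant
    first column to its top entry. Expanding along that column leaves the differences, where column
    [j] carries a factor [j.+1]; these factors make up the factorial. *)
Lemma det_rows_pairmap n k d : size d = n ->
  det_rows n (pairmap ffact_diff k d) = vdm (k :: d) / (n`!)%:R.
Proof.
move=> sz; rewrite -(@det_rows_ffact n.+1) /=; last by rewrite sz.
pose B : 'M[rat]_n.+1 := \matrix_(i, j) ffact_row (nth 0%N (k :: d) i) j.
(* Left multiplication by [D] performs the row subtractions. *)
pose D : 'M[rat]_n.+1 := \matrix_(i, j) ((i == j)%:R - (i == j.+1 :> nat)%:R).
have detD : \det D = 1.
  rewrite det_trig; last first.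
    apply/is_trig_mxP => i j ij; rewrite !mxE -val_eqE /=.
    have -> : ((i : nat) == j) = false by lia.
    have -> : ((i : nat) == j.+1) = false by lia.
    by rewrite subr0.
  apply: big1 => i _; rewrite !mxE eqxx.
  have -> : ((i : nat) == i.+1) = false by lia.
  by rewrite subr0.
have DB0 j : (D *m B) ord0 j = B ord0 j.
  rewrite mxE (bigD1 ord0) //= big1 ?addr0 => [|m m0].
    by rewrite mxE eqxx subr0 mul1r.
  by rewrite mxE eq_sym (negPf m0) subr0 mul0r.
have DBS i j : (D *m B) (lift ord0 i) j =
    ffact_row (nth 0%N d i) j - ffact_row (nth 0%N (k :: d) i) j.
  rewrite mxE (bigD1 (lift ord0 i)) //= (bigD1 (widen_ord (leqnSn n) i)) /=; last first.
    by rewrite -val_eqE /=; apply/eqP; rewrite /bump /=; lia.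
  rewrite big1 ?addr0 => [|m /andP[m1 m2]].
    rewrite !mxE eqxx /= -!val_eqE /= /bump /= add1n eqxx.
    have -> : (i.+1 == i.+2) = false by lia.
    have -> : (i.+1 == i) = false by lia.
    by rewrite subr0 mul1r sub0r mulN1r.
  rewrite mxE eq_sym (negPf m1); move: m2; rewrite -val_eqE /= /bump add1n eqSS eq_sym.
  by move/negPf ->; rewrite subr0 mul0r.
have -> : det_rows n.+1 (ffact_row k :: [seq ffact_row i | i <- d]) = \det (D *m B).
  rewrite det_mulmx detD mul1r /det_rows; congr (\det _); apply/matrixP=> i j.
  by rewrite !mxE -[_ :: _]/(map _ (k :: d)) (nth_map 0%N) //= sz.
rewrite (expand_det_col _ ord0) (bigD1 ord0) //= [X in _ + X]big1 ?addr0; last first.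
  move=> i i0.
  case: (unliftP ord0 i) i0 => [i' ->|->]; last by rewrite eqxx.
  by rewrite DBS /ffact_row !ffactn0 subrr mul0r.
rewrite DB0 mxE /ffact_row ffactn0 mul1r /cofactor /= addn0 expr0 mul1r.
pose E : 'M[rat]_n := \matrix_(i, j) nth (fun=> 0) (pairmap ffact_diff k d) i j.
have -> : row' ord0 (col' ord0 (D *m B)) =
          E *m diag_mx (\row_(j < n) (j.+1)%:R).
  apply/matrixP=> i j; rewrite mul_mx_diag !mxE.
  have -> : \sum_j0 D (lift ord0 i) j0 * B j0 (lift ord0 j) =
     (D *m B) (lift ord0 i) (lift ord0 j) by rewrite mxE.
  rewrite DBS (nth_pairmap 0%N) ?sz // /ffact_diff /= /bump add1n.
  by rewrite divfK // pnatr_eq0.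
rewrite det_mulmx det_diag.
have -> : \prod_(i < n) (\row_(j < n) (j.+1)%:R : 'rV[rat]_n) 0 i = (n`!)%:R.
  under eq_bigr do rewrite mxE.
  by rewrite -natr_prod fact_prod big_add1 /= big_mkord.
by rewrite mulfK // pnatr_eq0 -lt0n fact_gt0.
Qed.

Lemma interlacing_sum_size_neq n (G : seq nat -> rat) sigma k d :
  (forall s, size s != n -> G s = 0) -> (size sigma + size d != n)%N ->
  interlacing_sum G sigma k d = 0.
Proof.
move=> G0; elim: d sigma k => [|d1 d IHd] sigma k /=.
  by rewrite addn0; apply: G0.
by move=> sz; apply: big1 => s _; rewrite IHd // size_rcons addSnnS.
Qed.

Lemma eq_interlacing_sum (G G' : seq nat -> rat) sigma k d :
  (forall s, size s = (size sigma + size d)%N -> G s = G' s) ->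
  interlacing_sum G sigma k d = interlacing_sum G' sigma k d.
Proof.
elim: d sigma k => [|d1 d IHd] sigma k /= GG'; first by rewrite GG' ?addn0.
by apply: eq_bigr => s _; apply: IHd => t; rewrite size_rcons addSnnS; apply: GG'.
Qed.

Lemma H_S n : H n.+1 = H n * (n`!)%:R.
Proof. by rewrite /H /hyperfactorial big_ord_recr natrM. Qed.

Lemma H_neq0 n : H n != 0.
Proof.
elim: n => [|n IHn]; first by rewrite /H /hyperfactorial big_ord0 oner_eq0.
by rewrite H_S mulf_neq0 // pnatr_eq0 -lt0n fact_gt0.
Qed.

(** The expected count for [n] rows: each row has one up-pointing triangle more than down-pointing
    ones, hence the demand for exactly [n] dents. *)
Definition dent_count n (s : seq nat) : rat :=
  if size s == n then vdm s / H n else 0.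

(** The recurrence matching the removal of the bottom row; the factorial produced by the summation
    is [H n.+1 / H n]. *)
Lemma interlacing_sum_dent_count n k d : path ltn k d ->
  interlacing_sum (dent_count n) [::] k d = dent_count n.+1 (k :: d).
Proof.
move=> pd; rewrite {2}/dent_count /= eqSS.
have [sz|sz] := eqVneq (size d) n; last first.
  apply: (@interlacing_sum_size_neq n) => // s /negPf sz'.
  by rewrite /dent_count sz'.
have lin (G : seq nat -> rat) a s0 k0 d0 :
    interlacing_sum (fun s => a * G s) s0 k0 d0 = a * interlacing_sum G s0 k0 d0.
  elim: d0 s0 k0 => //= d1 d0 IH s0 k0; rewrite mulr_sumr.
  by apply: eq_bigr => s _; rewrite IH.
rewrite (@eq_interlacing_sum _
  (fun s => (H n)^-1 * det_rows n (map ffact_row s))); last first.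
  by move=> s /= ss; rewrite /dent_count ss sz eqxx mulrC det_rows_ffact // ss sz.
rewrite lin interlacing_sum_det // det_rows_pairmap // H_S /=.
by rewrite invfM; ring.
Qed.

End Determinants.

(** * Tilings of dented trapezoids *)

Lemma in_fset_sep (A : region) (P : pred utriangle) t :
  (t \in [fset u in A | P u]%fset) = (t \in A) && P t.
Proof. by rewrite !inE. Qed.

Lemma mem_parallelogram w h i j b :
  ((i, j, b) \in parallelogram w h) = (i < w) && (j < h).
Proof.
rewrite /parallelogram in_fset; apply/allpairsP/andP.
  case=> -[p up] /= [/allpairsP[[i' j'] /= [+ + ->]] _ [-> -> _]].
  by rewrite !mem_iota !add0n.
case=> iw jh; exists ((i, j), b); split=> //=; last by rewrite !inE; case: b.
by apply/allpairsP; exists (i, j); rewrite !mem_iota iw jh.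
Qed.

(** [T] is the length of the bottom side and [N] the number of rows. *)
Definition in_trapezoid (T N : nat) (t : utriangle) : bool :=
  let: (i, j, b) := t in (j < N) && (i + j + ~~ b < T).

Definition dented (T N : nat) (D : pred nat) : region :=
  [fset t in parallelogram T N | in_trapezoid T N t && ~~ crossed_up 0 D t]%fset.

Lemma in_dented T N D i j b : ((i, j, b) \in dented T N D) =
  [&& j < N, i + j + ~~ b < T & ~~ [&& b, j == 0 & D i]].
Proof.
rewrite in_fset_sep mem_parallelogram /crossed_up /level /=.
by case: b; case: (D i); rewrite /= ?andbF ?andbT; lia.
Qed.

(* What remains of [dented T.+1 N.+1 D] when its bottom row has been tiled from
   left to right up to position [p] (up-pointing triangles) and [q]
   (down-pointing ones); [S] is the set of vertical lozenges used so far. *)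
Definition scan (T N p q : nat) (D S : pred nat) : region :=
  [fset t in parallelogram T.+1 N.+1 |
    let: (i, j, b) := t in
    if j is j'.+1 then in_trapezoid T N (i, j', b) && ~~ [&& b, j' == 0 & S i]
    else if b then (p <= i <= T) && ~~ D i else q <= i < T]%fset.

Lemma in_scan0 T N p q D S i b : ((i, 0, b) \in scan T N p q D S) =
  if b then (p <= i <= T) && ~~ D i else q <= i < T.
Proof.
rewrite in_fset_sep mem_parallelogram /= ltnS andbT; case: b => /=; last by lia.
by case: (D i); rewrite ?andbF //=; lia.
Qed.

Lemma in_scanS T N p q D S i j b : ((i, j.+1, b) \in scan T N p q D S) =
  [&& j < N, i + j + ~~ b < T & ~~ [&& b, j == 0 & S i]].
Proof.
rewrite in_fset_sep mem_parallelogram /=.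
by case: b => /=; case: (S i); rewrite ?andbF ?andbT /=; lia.
Qed.

Definition in_scan := (in_scan0, in_scanS).

Lemma neighbours_down0P i k l b : neighbours (i, 0, false) (k, l, b) ->
  [\/ (k, l, b) = (i, 0, true), (k, l, b) = (i.+1, 0, true) |
      (k, l, b) = (i, 1, true)].
Proof.
case: b => //= /or3P[] /andP[/eqP <- /eqP <-];
  [exact: Or31 | exact: Or32 | exact: Or33].
Qed.

Lemma neighbours_up0P i k l b : neighbours (i, 0, true) (k, l, b) ->
  (k, l, b) = (i, 0, false) \/ (k.+1, l, b) = (i, 0, false).
Proof.
case: b => //= /or3P[] /andP[/eqP -> /eqP] //; first by move=> <-; left.
by move=> <-; right.
Qed.

Section Scan.
Variables (T N : nat) (D : pred nat).

(** The up-pointing triangle at [k] has lost its left partner, so it is matched with the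
    down-pointing one on its right. *)
Lemma scan_skip k S : k < T -> ~~ D k ->
  M (scan T N k k D S) = M (scan T N k.+1 k.+1 D S).
Proof.
move=> kT nDk; rewrite (@M_forced _ (k, 0, true) (k, 0, false)).
- congr M; apply/fsetP => -[[i j] b]; rewrite in_fsetD1 in_fsetD1 !xpair_eqE.
  case: j => [|j]; rewrite !in_scan /= ?andbF //=.
  by case: b => /=; case: (eqVneq i k) => [->|ik]; case: (D _) => //=; lia.
- by rewrite in_scan nDk leqnn ltnW.
- by rewrite in_scan leqnn kT.
- by rewrite /= !eqxx.
- move=> [[i j] b] uR /neighbours_up0P[-> //|[ik jE bE]].
  by move: uR; rewrite jE bE in_scan; lia.
Qed.

(** The last up-pointing triangle of the row has only a left partner, which is already used. *)
Lemma scan_dead S : ~~ D T -> M (scan T N T T D S) = 0.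
Proof.
move=> nDT; apply: (@M_isolated _ (T, 0, true)).
  by rewrite in_scan leqnn nDT.
move=> [[i j] b] + ; apply: contraL => /neighbours_up0P[[-> -> ->]|[<- -> ->]];
  rewrite in_scan; lia.
Qed.

Lemma scan_dent k S : D k -> scan T N k k D S = scan T N k.+1 k D S.
Proof.
move=> Dk; apply/fsetP => -[[i j] b]; case: j => [|j]; rewrite !in_scan //.
case: b => //; case: (eqVneq i k) => [->|ik]; first by rewrite Dk !andbF.
by case: (D i); rewrite ?andbF //; lia.
Qed.

(** The down-pointing triangle at [k] has lost its left partner. It is matched upwards, which adds
    [k] to [S] and needs a row above, or with the next up-pointing triangle unless that is a
    dent. *)
Lemma scan_pending k (S : pred nat) : k < T -> (forall i, S i -> i < k) ->
  M (scan T N k.+1 k D S) =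
  (0 < N) * M (scan T N k.+1 k.+1 D (predU1 k S)) +
  (~~ D k.+1) * M (scan T N k.+2 k.+1 D S).
Proof.
move=> kT Sk; have tR : (k, 0, false) \in scan T N k.+1 k D S.
  by rewrite in_scan leqnn.
have nSk : S k = false by apply/negP => /Sk; rewrite ltnn.
have u1E : ((k, 1, true) \in scan T N k.+1 k D S) = (0 < N).
  by rewrite in_scan nSk /=; lia.
have u2E : ((k.+1, 0, true) \in scan T N k.+1 k D S) = ~~ D k.+1.
  by rewrite in_scan leqnn kT.
rewrite (M_expand tR) (bigID (pred1 (k, 1, true))) /=; congr addn.
- have [N0|N0] := boolP (0 < N); last first.
    rewrite mul0n big_seq_cond big1 // => u /andP[uR /andP[_ /eqP uE]].
    by move: uR; rewrite uE u1E (negPf N0).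
  rewrite mul1n -big_filter (_ : [seq _ <- _ | _] = [:: (k, 1, true)]).
    rewrite big_seq1; congr M; apply/fsetP => -[[i j] b].
    rewrite in_fsetD1 in_fsetD1 !xpair_eqE.
    case: j => [|j]; rewrite !in_scan /= ?andbF ?andbT /=.
      by case: b => //=; lia.
    case: (eqVneq i k) => [->|ik] //=; rewrite ?nSk ?andbF /=.
    by case: b => //=; lia.
  apply: perm_small_eq => //; apply: uniq_perm => //.
    by rewrite filter_uniq // fset_uniq.
  move=> u; rewrite mem_filter mem_seq1.
  apply/idP/eqP => [/andP[/andP[_ /eqP]] //|->]; by rewrite u1E N0 /= !eqxx !orbT.
have [D1|D1] := boolP (D k.+1).
  rewrite mul0n big_seq_cond big1 // => -[[i j] b] /andP[uR /andP[]].
  move=> /neighbours_down0P[] uE; move: uR; rewrite uE ?eqxx // ?u2E ?D1 //.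
  by rewrite in_scan ltnn.
rewrite mul1n -big_filter (_ : [seq _ <- _ | _] = [:: (k.+1, 0, true)]).
  rewrite big_seq1; congr M; apply/fsetP => -[[i j] b].
  rewrite in_fsetD1 in_fsetD1 !xpair_eqE.
  case: j => [|j]; rewrite !in_scan /= ?andbF ?andbT //=.
  by case: b => //=; case: (D i); rewrite ?andbF //=; lia.
apply: perm_small_eq => //; apply: uniq_perm => //.
  by rewrite filter_uniq // fset_uniq.
move=> [[i j] b]; rewrite mem_filter mem_seq1.
apply/idP/eqP => [/andP[/andP[]]|[-> -> ->]].
  by move=> /neighbours_down0P[] // ->; rewrite ?eqxx // in_scan ltnn.
rewrite u2E D1 andbT; apply/andP; split; last by apply/eqP => -[]; lia.
by rewrite !eqxx !orbT.
Qed.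

Lemma scan_end S : M (scan T N T.+1 T D S) = M (dented T N S).
Proof.
pose f (t : utriangle) : utriangle := (t.1.1, t.1.2.-1, t.2).
pose g (t : utriangle) : utriangle := (t.1.1, t.1.2.+1, t.2).
have row0 i b : ((i, 0, b) \in scan T N T.+1 T D S) = false.
  rewrite in_scan; case: b; last by lia.
  by case: (D i); rewrite ?andbF //; lia.
apply: (@M_transport _ _ f g).
- move=> [[i j] b]; case: j => [|j]; first by rewrite row0.
  by rewrite in_scan /f /= in_dented.
- by move=> [[i j] b]; rewrite in_dented /g /= in_scan.
- by move=> [[i j] b]; case: j => [|j] //; rewrite row0.
- by move=> [[i j] b].
- move=> [[i j] b] [[k l] c]; case: j => [|j]; first by rewrite row0.
  by case: l => [|l]; [rewrite row0 | rewrite /f /=; case: b; case: c].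
Qed.

(** For [N = 0] the region is empty and has one tiling whatever the dents, whereas [dent_count] is 0
    on nonempty dents; the last condition excludes this case. *)
Hypothesis M_smaller : forall sigma : seq nat, sorted ltn sigma ->
  all (fun i => i < T) sigma -> (0 < N) || (sigma == [::]) ->
  ((M (dented T N (mem sigma)))%:R = dent_count N sigma)%R.

Lemma scan_extensional p q (S S' : pred nat) : S =1 S' ->
  scan T N p q D S = scan T N p q D S'.
Proof.
move=> SS'; apply/fsetP => -[[i j] b].
by case: j => [|j]; rewrite !in_scan // SS'.
Qed.

(** The first count has a down-pointing triangle waiting at [k], the second is balanced. A dent
    leaves a triangle waiting and a vertical lozenge restores balance, so exactly one such lozenge
    lies between consecutive dents: this is the interlacing. *)
Lemma M_scan r k sigma : k + r = T -> sorted ltn sigma ->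
  all (fun i => i < k) sigma -> (0 < N) || (sigma == [::]) ->
  ((M (scan T N k.+1 k D (mem sigma)))%:R =
    interlacing_sum (dent_count N) sigma k [seq i <- iota k.+1 r | D i])%R /\
  ((M (scan T N k k D (mem sigma)))%:R =
    if [seq i <- iota k r.+1 | D i] is d0 :: d' then
      interlacing_sum (dent_count N) sigma d0 d' else 0)%R.
Proof.
elim: r k sigma => [|r IHr] k sigma krT srt ltk N0.
  rewrite addn0 in krT; subst k => /=.
  have c1 : ((M (scan T N T.+1 T D (mem sigma)))%:R = dent_count N sigma)%R.
    by rewrite scan_end M_smaller.
  split=> //; case: ifPn => DT; first by rewrite scan_dent.
  by rewrite scan_dead.
have kT : k < T by lia.
have skr : k.+1 + r = T by lia.
have ltk' : all (fun i => i < k.+1) sigma.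
  by apply: sub_all ltk => i; apply: ltnW.
have [IH1 IH2] := IHr k.+1 sigma skr srt ltk' N0.
set S := mem sigma.
have srt' : sorted ltn (rcons sigma k).
  case: (sigma) srt ltk => //= x s xs /andP[xk sk]; rewrite rcons_path xs /=.
  by move: (mem_last x s); rewrite inE => /orP[/eqP ->|/(allP sk)].
have ltk'' : all (fun i => i < k.+1) (rcons sigma k).
  by rewrite all_rcons ltnSn ltk'.
have SE : predU1 k S =1 mem (rcons sigma k).
  by move=> i; rewrite /= mem_rcons inE.
have pend : ((M (scan T N k.+1 k D S))%:R =
   interlacing_sum (dent_count N) sigma k [seq i <- iota k.+1 r.+1 | D i])%R.
  have Sk i : S i -> i < k by move=> iS; apply: (allP ltk).
  rewrite (scan_pending kT Sk) natrD !natrM (scan_extensional _ _ SE).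
  have [N1|N1] := boolP (0 < N); last first.
    have z s0 d0 d : (0 < size s0 + size d) ->
        interlacing_sum (dent_count N) s0 d0 d = 0%R.
      move=> sz; apply: (@interlacing_sum_size_neq N) => [s|]; last by lia.
      by rewrite /dent_count => /negPf ->.
    rewrite mul0r add0r IH1 /=; case: (D k.+1) => /=.
      by rewrite mul0r big_nat1 z // size_rcons.
    rewrite mul1r; case: [seq i <- iota k.+2 r | D i] => [|d1 d'] //.
    by rewrite !z ?addnS.
  rewrite mul1r; have [IH1' IH2'] := IHr k.+1 _ skr srt' ltk'' (ltac:(by rewrite N1)).
  rewrite IH2' /=; have [D1|D1] := boolP (D k.+1).
    by rewrite /= mul0r addr0 big_nat1.
  rewrite mul1r IH1.
  case E: [seq i <- iota k.+2 r | D i] => [|d1 d'] /=; first by rewrite add0r.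
  (* The term [s = k] is the vertical lozenge at [k]; the other terms keep a triangle waiting. *)
  rewrite [RHS]big_ltn //.
  have : d1 \in [seq i <- iota k.+2 r | D i] by rewrite E inE eqxx.
  by rewrite mem_filter mem_iota; lia.
split=> //; have [Dk|Dk] := boolP (D k).
  by rewrite [iota k _]/= /= Dk scan_dent.
by rewrite [iota k _]/= /= (negPf Dk) scan_skip.
Qed.
End Scan.

Lemma sorted_filter_iota (P : pred nat) m n : sorted ltn [seq i <- iota m n | P i].
Proof. exact: sorted_filter ltn_trans _ _ (iota_ltn_sorted m n). Qed.

Lemma filter_iota_mem (s : seq nat) m n : sorted ltn s ->
  all (fun i => m <= i < m + n) s -> [seq i <- iota m n | i \in s] = s.
Proof.
move=> srt bnd; apply: (irr_sorted_eq ltn_trans ltnn) => //.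
  exact: sorted_filter_iota.
move=> i; rewrite mem_filter mem_iota; apply: andb_idr => /(allP bnd).
by [].
Qed.

(* The formula of Cohn, Larsen and Propp. *)
Theorem M_dented T N (D : pred nat) : N <= T ->
  (0 < N) || ([seq i <- iota 0 T | D i] == [::]) ->
  ((M (dented T N D))%:R = dent_count N [seq i <- iota 0 T | D i])%R.
Proof.
elim: N T D => [|N IHN] T D NT.
  rewrite /= => /eqP ->; rewrite (_ : dented _ _ _ = fset0) ?M_fset0.
    by rewrite /dent_count /H /hyperfactorial big_ord0 divr1.
  by apply/fsetP => -[[i j] b]; rewrite in_dented.
case: T NT => // T NT _.
have -> : dented T.+1 N.+1 D = scan T N 0 0 D (mem [::]).
  apply/fsetP => -[[i j] b]; rewrite in_dented.
  by case: j => [|j]; rewrite in_scan; case: b; case: (D i); rewrite /= ?andbF /=; lia.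
have smaller (sigma : seq nat) : sorted ltn sigma ->
    all (fun i => i < T) sigma -> (0 < N) || (sigma == [::]) ->
    ((M (dented T N (mem sigma)))%:R = dent_count N sigma)%R.
  move=> srt lt N0.
  have sE : [seq i <- iota 0 T | mem sigma i] = sigma by apply: filter_iota_mem.
  by rewrite IHN // sE.
have [_ ->] := @M_scan T N D smaller T 0 [::] (add0n _) isT isT (orbT _).
have := sorted_filter_iota D 0 T.+1.
by case: [seq i <- _ | _] => [|d0 d'] // pd; rewrite interlacing_sum_dent_count.
Qed.

(** * Forced lozenges inside triangular dents *)

Lemma M_forced_row (R : region) (k : nat) (L : seq nat) : uniq L ->
  (forall i, i \in L -> [&& (i, k, false) \in R, (i, k.+1, true) \in R,
     (i, k, true) \notin R & (i.+1, k, true) \notin R]) ->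
  M R = M [fset u in R | ~~ ((u.1.1 \in L) && (level u == k + u.2)%N)]%fset.
Proof.
elim: L R => [|x L IHL] R /=.
  by move=> _ _; congr M; apply/fsetP=> u; rewrite in_fset_sep andbT.
case/andP=> xL uL cond.
have := cond x; rewrite mem_head => /(_ isT) /and4P[tR uR n1 n2].
rewrite (@M_forced _ (x, k, false) (x, k.+1, true)) //.
- rewrite IHL //.
    congr M; apply/fsetP => -[[i j] b].
    rewrite !in_fset_sep !in_fsetD1 !xpair_eqE /level /= inE.
    case: (_ \in R); rewrite ?andbF //= ?andbT.
    by case: (eqVneq i x) => [->|ix] /=; rewrite ?(negPf xL); case: b => //=;
       rewrite ?andbT ?andbF //=; lia.
  move=> i iL; have := cond i; rewrite inE iL orbT => /(_ isT) /and4P[d1 d2 m1 m2].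
  have ix : i != x by apply: contraNneq xL => <-.
  by rewrite !in_fsetD1 !xpair_eqE d1 d2 (negPf m1) (negPf m2) (negPf ix) /= !andbF.
- by rewrite /= !eqxx !orbT.
- move=> [[i j] [|]] // vR /or3P[] /andP[/eqP iE /eqP jE]; subst; last by [].
    by rewrite vR in n1.
  by rewrite vR in n2.
Qed.

(** Meant for a union [F] of triangles standing on the base line. Once their bottom rows are gone,
    each down-pointing triangle of [F] has lost both partners in its row and is matched upwards, row
    after row. *)
Lemma M_forced_dents (R : region) (F : pred utriangle) :
  (forall i j, F (i, j, false) = F (i, j.+1, true)) ->
  (forall i j, F (i, j, false) -> F (i, j, true) && F (i.+1, j, true)) ->
  (forall i j, F (i, j, false) -> ((i, j, false) \in R) && ((i, j.+1, true) \in R)) ->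
  M [fset u in R | ~~ F u]%fset =
  M [fset u in R | ~~ (F u && (u.2 && (level u == 0)))]%fset.
Proof.
move=> Fpair Fbelow FR.
(* The base row of [F] together with its first [k] layers of vertical lozenges. *)
pose E k u := F u && (level u < k + u.2).
have step k : M [fset u in R | ~~ E k u]%fset = M [fset u in R | ~~ E k.+1 u]%fset.
  have [n bnd] : exists n, forall u, u \in R -> u.1.1 < n.
    by exists (\max_(u <- R) u.1.1).+1 => u uR; rewrite ltnS (big_rem u) //= leq_maxl.
  rewrite (@M_forced_row _ k [seq i <- iota 0 n | F (i, k, false)]).
  - congr M; apply/fsetP => -[[i j] b]; rewrite !in_fset_sep /= mem_filter mem_iota /=.
    case uR: (_ \in R) => //=; rewrite (bnd _ uR) /E /level /= andbT.
    case: b {uR} => /=.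
      have [->|jk] := eqVneq j (k + 1).
        by rewrite addn1 -Fpair; case: (F _); rewrite //= ?andbF //; lia.
      by rewrite andbF andbT; case: (F _) => //=; lia.
    have [->|jk] := eqVneq j (k + 0).
      by rewrite addn0; case: (F _); rewrite //= ?andbF //; lia.
    by rewrite andbF andbT; case: (F _) => //=; lia.
  - by rewrite filter_uniq // iota_uniq.
  - move=> i; rewrite mem_filter => /andP[Fi _].
    have /andP[Fi1 Fi2] := Fbelow _ _ Fi; have /andP[dR uR] := FR _ _ Fi.
    by rewrite !in_fset_sep dR uR /E /level /= Fi1 Fi2 !addn1 !addn0 !ltnn ltnSn !andbF.
have steps k : M [fset u in R | ~~ E k u]%fset = M [fset u in R | ~~ E 0 u]%fset.
  by elim: k => // k <-; rewrite -step.
pose m := (\max_(u <- R) level u).+1.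
transitivity (M [fset u in R | ~~ E m u]%fset).
  congr M; apply/fsetP=> u; rewrite !in_fset_sep; case uR: (u \in R) => //=.
  rewrite /E ltn_addr ?andbT // ltnS (big_rem u) //= leq_maxl //.
rewrite steps; congr M; apply/fsetP=> u; rewrite !in_fset_sep /E add0n.
by case: u.2 => //=; rewrite ?ltnS ?leqn0 // ltn0.
Qed.

(** A fern seen from one side of its line: entries pointing to the other side count as distances
    only. *)
Fixpoint dent_triangles (up : bool) (p : nat) (t : seq nat) (u : utriangle) : bool :=
  if t is n :: t' then
    (up && in_triangle true (p, 0) n u) || dent_triangles (~~ up) (p + n) t' u
  else false.

Fixpoint dent_positions (up : bool) (p : nat) (t : seq nat) : seq nat :=
  if t is n :: t' then
    (if up then iota p n else [::]) ++ dent_positions (~~ up) (p + n) t'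
  else [::].

Lemma in_triangle_upE p l n i j b : in_triangle true (p, l) n (i, j, b) =
  [&& p <= i, l <= j & i + j + ~~ b < p + l + n].
Proof. rewrite /in_triangle; case: b => /=; lia. Qed.

Lemma dent_triangles_cat up p t1 t2 u : dent_triangles up p (t1 ++ t2) u =
  dent_triangles up p t1 u || dent_triangles (up (+) odd (size t1)) (p + sumn t1) t2 u.
Proof.
elim: t1 up p => [|n t1 IHt] up p /=; first by rewrite addbF addn0.
by rewrite IHt orbA addNb addbN addnA.
Qed.

Lemma dent_triangles_base up p t i :
  dent_triangles up p t (i, 0, true) = (i \in dent_positions up p t).
Proof.
elim: t up p => //= n t IHt up p; rewrite IHt mem_cat; congr orb.
by case: up => //; rewrite in_triangle_upE mem_iota; lia.
Qed.

Lemma dent_triangles_pair up p t i j :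
  dent_triangles up p t (i, j, false) = dent_triangles up p t (i, j.+1, true).
Proof.
elim: t up p => //= n t IHt up p; rewrite IHt; congr ((_ && _) || _).
by rewrite !in_triangle_upE; lia.
Qed.

Lemma dent_triangles_below up p t i j : dent_triangles up p t (i, j, false) ->
  dent_triangles up p t (i, j, true) && dent_triangles up p t (i.+1, j, true).
Proof.
elim: t up p => //= n t IHt up p /orP[/andP[-> H]|/IHt/andP[-> ->]]; last first.
  by rewrite !orbT.
by move: H; rewrite !in_triangle_upE /= => H; apply/andP; split; apply/orP; left; lia.
Qed.

Lemma dent_positions_bounds up p t :
  all (fun i => p <= i < p + sumn t) (dent_positions up p t).
Proof.
elim: t up p => //= n t IHt up p; rewrite all_cat; apply/andP; split.
  by case: up => //; apply/allP => i; rewrite mem_iota; lia.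
by apply: sub_all (IHt _ _) => i; lia.
Qed.

Lemma dent_positions_sorted up p t : sorted ltn (dent_positions up p t).
Proof.
elim: t up p => //= n t IHt up p; rewrite (sorted_pairwise ltn_trans) pairwise_cat.
rewrite -!(sorted_pairwise ltn_trans) IHt andbT; apply/andP; split; last first.
  by case: up => //; apply: iota_ltn_sorted.
apply/allrelP => x y xi /(allP (dent_positions_bounds _ _ _)) /andP[yp _].
by case: up xi => //; rewrite mem_iota; lia.
Qed.

(** A triangle of side [n] contributes [n] positions, so a bound on their number bounds its
    height. *)
Lemma dent_triangles_trapezoid T N up p t u : dent_triangles up p t u ->
  p + sumn t <= T -> size (dent_positions up p t) <= N -> in_trapezoid T N u.
Proof.
case: u => -[i j] b; elim: t up p => //= n t IHt up p.
rewrite size_cat => /orP[/andP[-> H]|H] pT sz; last by apply: IHt H _ _; lia.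
by move: H sz; rewrite in_triangle_upE size_iota; case: b {IHt} => /=; lia.
Qed.

Lemma M_dented_triangles T N (S : pred nat) t :
  sumn t <= T -> size (dent_positions true 0 t) <= N ->
  M [fset u in dented T N S | ~~ dent_triangles true 0 t u]%fset =
  M (dented T N (predU (mem (dent_positions true 0 t)) S)).
Proof.
move=> tT sz; rewrite M_forced_dents.
- congr M; apply/fsetP => -[[i j] b]; rewrite in_fset_sep !in_dented /level /=.
  case: b => /=; rewrite ?andbF ?andbT //.
  have [->|j0] := eqVneq j 0; last by rewrite !andbF !andbT.
  by rewrite dent_triangles_base; case: (i \in _); case: (S i); rewrite ?andbF ?andbT.
- exact: dent_triangles_pair.
- exact: dent_triangles_below.
- move=> i j H; have := H; rewrite dent_triangles_pair => H'.
  have := dent_triangles_trapezoid H; move/(_ T N tT sz).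
  have := dent_triangles_trapezoid H'; move/(_ T N tT sz).
  by rewrite !in_dented /=; lia.
Qed.

(** * Factorization of products of differences *)

Section VandermondeProducts.
Local Open Scope ring_scope.

Definition cross_prod (s t : seq nat) : rat :=
  \prod_(x <- s) \prod_(y <- t) (y%:R - x%:R).

Lemma vdm_cat s t : vdm (s ++ t) = vdm s * vdm t * cross_prod s t.
Proof.
elim: s => [|x s IHs] /=; first by rewrite /cross_prod big_nil mul1r mulr1.
by rewrite IHs /cross_prod big_cons big_cat /=; ring.
Qed.

Lemma cross_prod_cat s t1 t2 :
  cross_prod s (t1 ++ t2) = cross_prod s t1 * cross_prod s t2.
Proof.
by rewrite /cross_prod -big_split; apply: eq_bigr => x _; rewrite big_cat.
Qed.

Lemma vdm_shift p s : vdm [seq p + i | i <- s]%N = vdm s.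
Proof.
elim: s => //= x s ->; congr (_ * _); rewrite big_map; apply: eq_bigr => y _.
by rewrite !natrD; ring.
Qed.

Lemma vdm_iota p n : vdm (iota p n) = H n.
Proof.
rewrite -[p]addn0 iotaDl vdm_shift {p}.
elim: n => [|n IHn]; first by rewrite /H /hyperfactorial big_ord0.
rewrite H_S mulrC -[iota 0 n.+1]/(0%N :: iota (1 + 0) n) iotaDl /= vdm_shift IHn.
congr (_ * _); rewrite big_map fact_prod natr_prod big_add1 /= /index_iota subn0.
by apply: eq_bigr => i _; rewrite subr0.
Qed.

(** The differences between the intervals are those between [[0, Y)] and [[Y, Y + h + c)] divided by
    those between [[0, Y)] and [[Y, Y + h)]; both come from splitting an interval of consecutive
    integers. *)
Lemma vdm_two_intervals Y h c : vdm (iota 0 Y ++ iota (Y + h) c) =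
  H Y * H c * H (Y + h + c) * H h / (H (h + c) * H (Y + h)).
Proof.
have E1 : H (Y + h) = H Y * H h * cross_prod (iota 0 Y) (iota Y h).
  by rewrite -(vdm_iota 0) iotaD vdm_cat !vdm_iota.
have E2 : H (Y + h + c) = H Y * H (h + c) *
   (cross_prod (iota 0 Y) (iota Y h) * cross_prod (iota 0 Y) (iota (Y + h) c)).
  rewrite -(vdm_iota 0) -addnA iotaD vdm_cat !vdm_iota add0n.
  by rewrite [iota Y _]iotaD cross_prod_cat.
have n0 : cross_prod (iota 0 Y) (iota Y h) != 0.
  by have := H_neq0 (Y + h); rewrite E1 mulf_eq0 negb_or => /andP[].
rewrite vdm_cat !vdm_iota E1 E2.
by field; rewrite ?n0 ?H_neq0.
Qed.

(** Indexing by all pairs below [T] lets products over different sets be compared factor by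
    factor. *)
Definition pair_prod (T : nat) (f : nat -> nat -> rat) : rat :=
  \prod_(0 <= j < T) \prod_(0 <= i < j) f i j.

Lemma vdm_filter T (D : pred nat) : vdm [seq i <- iota 0 T | D i] =
  pair_prod T (fun i j => if D i && D j then j%:R - i%:R else 1).
Proof.
elim: T => [|T IHT]; first by rewrite /pair_prod big_nil.
have -> : iota 0 T.+1 = iota 0 T ++ [:: T] by rewrite -addn1 iotaD.
rewrite /pair_prod big_nat_recr //= -/(pair_prod T _) -IHT filter_cat vdm_cat /=.
case DT: (D T) => /=; last first.
  rewrite /cross_prod !big1 ?mulr1 // => i _; first by rewrite andbF.
  by rewrite big_nil.
rewrite big_nil !mulr1; congr (_ * _); rewrite /cross_prod big_filter.
rewrite /index_iota subn0 big_mkcond; apply: eq_bigr => i _.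
by rewrite big_seq1 andbT.
Qed.

Lemma pair_prodM T f g :
  pair_prod T f * pair_prod T g = pair_prod T (fun i j => f i j * g i j).
Proof.
by rewrite /pair_prod -big_split; apply: eq_bigr => j _; rewrite big_split.
Qed.

Lemma eq_pair_prod T f g : (forall i j, (i < j < T)%N -> f i j = g i j) ->
  pair_prod T f = pair_prod T g.
Proof.
move=> fg; rewrite /pair_prod big_nat [RHS]big_nat; apply: eq_bigr => j jT.
rewrite big_nat [RHS]big_nat; apply: eq_bigr => i ij; apply: fg; lia.
Qed.

Definition gap_weight (G S : pred nat) (i j : nat) : rat :=
  if S i && S j then (j%:R - i%:R) ^+ 2
  else if (S i && ~~ G j) || (S j && ~~ G i) then j%:R - i%:R else 1.

(* The weight of [S] sees only the gaps, not how the complement of the gaps is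
   shared between [U] and [L]. *)
Lemma vdm_gap_factor T (U L S G : pred nat) :
  (forall i, (i < T)%N -> ~~ (U i && L i)) ->
  (forall i, (i < T)%N -> G i = ~~ U i && ~~ L i) ->
  (forall i, (i < T)%N -> S i -> G i) ->
  vdm [seq i <- iota 0 T | predU U S i] * vdm [seq i <- iota 0 T | predU L S i] =
  vdm [seq i <- iota 0 T | U i] * vdm [seq i <- iota 0 T | L i] *
  pair_prod T (gap_weight G S).
Proof.
move=> UL GE SG; rewrite !vdm_filter !pair_prodM.
apply: eq_pair_prod => i j /andP[ij jT]; have iT := ltn_trans ij jT.
rewrite /gap_weight /=.
have := SG i iT; have := SG j jT; rewrite !GE //.
have := UL i iT; have := UL j jT.
case: (U i); case: (U j); case: (L i); case: (L j); case: (S i); case: (S j) => //=;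
  do ?[by move=> _ _ _ /(_ isT) | by move=> _ _ /(_ isT)] => *;
  by rewrite ?mulr1 ?mul1r ?expr2.
Qed.

End VandermondeProducts.

(** * Dented semihexagons and ferns as patterns of dents *)

Lemma osum_cons n t : osum (n :: t) = n + esum t.
Proof.
rewrite /osum /esum big_mkcond big_ord_recl /= [in RHS]big_mkcond /=.
by congr addn; apply: eq_bigr => i _; rewrite negbK.
Qed.

Lemma esum_cons n t : esum (n :: t) = osum t.
Proof.
rewrite /osum /esum big_mkcond big_ord_recl /= [in RHS]big_mkcond /= add0n.
by apply: eq_bigr.
Qed.

Lemma size_dent_positions up p t :
  size (dent_positions up p t) = if up then osum t else esum t.
Proof.
elim: t up p => [|n t IHt] up p /=; first by case: up; rewrite /osum /esum big_ord0.
by rewrite size_cat IHt; case: up; rewrite /= ?size_iota ?osum_cons ?esum_cons.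
Qed.

Lemma osumDesum t : osum t + esum t = sumn t.
Proof.
elim: t => [|n t IHt]; first by rewrite /osum /esum !big_ord0.
by rewrite osum_cons esum_cons /= -IHt addnAC addnA.
Qed.

Lemma has_iotaS (f : pred nat) n :
  has f (iota 0 n.+1) = f 0 || has (fun k => f k.+1) (iota 0 n).
Proof. by rewrite /= -[iota 1 n]/(iota (1 + 0) n) iotaDl has_map. Qed.

Lemma has_dent_triangles up p t u :
  has (fun k => (up (+) odd k) &&
         in_triangle true (p + sumn (take k t), 0) (nth 0 t k) u)
      (iota 0 (size t)) = dent_triangles up p t u.
Proof.
elim: t up p => // n t IHt up p; rewrite [size _]/= has_iotaS /= addbF addn0 -IHt.
by congr orb; apply: eq_has => k; rewrite /= addNb addbN addnA.
Qed.

Lemma dented_semihexagonE t : dented_semihexagon t =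
  [fset u in dented (sumn t) (osum t) pred0 | ~~ dent_triangles true 0 t u]%fset.
Proof.
apply/fsetP => u; rewrite [LHS]in_fset_sep [RHS]in_fset_sep.
rewrite -has_dent_triangles; congr (_ && ~~ _).
  case: u => -[i j] b; rewrite in_dented in_fset_sep mem_parallelogram osumDesum.
  by case: b => /=; lia.
Qed.

Lemma filter_iota_widen T T' (D : pred nat) : T <= T' ->
  (forall i, D i -> i < T) ->
  [seq i <- iota 0 T' | D i] = [seq i <- iota 0 T | D i].
Proof.
move=> TT' DT; rewrite -(subnKC TT') iotaD filter_cat.
rewrite [X in _ ++ X](_ : _ = [::]) ?cats0 //.
rewrite -(filter_pred0 (iota (0 + T) (T' - T))); apply: eq_in_filter => i.
by rewrite mem_iota => iT; apply/negP => /DT; lia.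
Qed.

Lemma s_vdm t : ((s t)%:R = vdm (dent_positions true 0 t) / H (osum t))%R.
Proof.
rewrite /s dented_semihexagonE M_dented_triangles //; last first.
  by rewrite size_dent_positions.
have pE : [seq i <- iota 0 (sumn t) |
    predU (mem (dent_positions true 0 t)) pred0 i] = dent_positions true 0 t.
  rewrite -[RHS](@filter_iota_mem _ 0 (sumn t)) ?dent_positions_bounds //.
    by apply: eq_filter => i; rewrite /= orbF.
  exact: dent_positions_sorted.
rewrite M_dented ?pE; first by rewrite /dent_count size_dent_positions eqxx.
- by rewrite -osumDesum leq_addr.
- by rewrite -size_eq0 size_dent_positions lt0n orNb.
Qed.

Lemma in_fern_above up v l t i j b : l <= j ->
  in_fern up (v, l) t (i, j, b) = dent_triangles up v t (i, j - l, b).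
Proof.
move=> lj; rewrite -has_dent_triangles /in_fern; apply: eq_has => k /=.
set w := v + _; set n := nth 0 t k; case: (up (+) odd k) => /=.
  by rewrite !in_triangle_upE; lia.
by rewrite /in_triangle; case: b => /=; lia.
Qed.

(** The triple on the right is the reflection of the triangle in the line at level [l], moved so
    that position [y] of the line becomes the origin. Reflection reverses orientations, hence
    [~~ up]. *)
Lemma in_fern_below up v y l t i j b : j < l -> l + y <= i + j + ~~ b ->
  in_fern up (y + v, l) t (i, j, b) =
  dent_triangles (~~ up) v t (i + j + ~~ b - (l + y), l.-1 - j, ~~ b).
Proof.
move=> lj yi; rewrite -has_dent_triangles /in_fern; apply: eq_has => k /=.
rewrite -addnA addNb; set w := v + _; set n := nth 0 t k; case: (up (+) odd k) => /=.
  by rewrite in_triangle_upE; lia.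
rewrite in_triangle_upE /in_triangle; case: b yi => /=; lia.
Qed.

(** * Gluing two dented trapezoids *)

Lemma dent_positions_shift y up p t :
  dent_positions up (y + p) t = [seq y + i | i <- dent_positions up p t].
Proof.
elim: t up p => //= n t IHt up p; rewrite -addnA IHt map_cat; congr (_ ++ _).
by case: up; rewrite //= iotaDl.
Qed.

Lemma filter_iota_shift (D : pred nat) y n : (forall i, D i -> y <= i) ->
  [seq i <- iota 0 (y + n) | D i] = [seq y + i | i <- [seq i <- iota 0 n | D (y + i)]].
Proof.
move=> Dy; rewrite iotaD filter_cat [X in X ++ _](_ : _ = [::]).
  by rewrite /= add0n -{1}[y]addn0 iotaDl filter_map.
rewrite -(filter_pred0 (iota 0 y)); apply: eq_in_filter => i.
by rewrite mem_iota => iT; apply/negP => /Dy; lia.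
Qed.

Lemma count_nat_in n (S : {set 'I_n}) : count (nat_in S) (iota 0 n) = #|S|.
Proof.
rewrite -val_enum_ord count_map cardE enumT -size_filter; congr size.
rewrite [RHS]/enum_mem -enumT; apply: eq_filter => i; exact: nat_in_ord.
Qed.

(** This is [Phi] of the overview. *)
Definition gap_sum (T z : nat) (G : pred nat) : rat :=
  (\sum_(S : {set 'I_T} | [forall i in S, G i] && (#|S| == z))
     pair_prod T (gap_weight G (nat_in S)))%R.

Section Gluing.

Variables (R : region) (l T Tu Tl y z : nat) (t1 t2 : seq nat) (G : pred nat).
(** Together with [lE], this gives both halves [z] rows more than prescribed dents, which fixes the
    number of vertical lozenges crossing the line. *)
Let Nu := osum t1 + z.
Let U : pred nat := mem (dent_positions true 0 t1).
Let L : pred nat := mem (dent_positions true y t2).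

Hypothesis lE : l = osum t2 + z.
(** Along the line the upper trapezoid occupies [[0, Tu)] and the lower one [[y, T)]. *)
Hypothesis TE : T = y + Tl.
Hypothesis Tu_le : Tu <= T.
Hypothesis t1_le : sumn t1 <= Tu.
Hypothesis t2_le : sumn t2 <= Tl.
Hypothesis Nu_le : Nu <= Tu.
Hypothesis l_le : l <= Tl.
Hypothesis R_above : forall (i j : nat) (b : bool), ((i, l + j, b) \in R) =
  in_trapezoid Tu Nu (i, j, b) && ~~ dent_triangles true 0 t1 (i, j, b).
Hypothesis R_below : forall (i j : nat) (b : bool), j < l -> ((i, j, b) \in R) =
  [&& l + y <= i + j + ~~ b,
      in_trapezoid Tl l (i + j + ~~ b - (l + y), l.-1 - j, ~~ b) &
      ~~ dent_triangles true 0 t2 (i + j + ~~ b - (l + y), l.-1 - j, ~~ b)].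
Hypothesis UL : forall i, i < T -> ~~ (U i && L i).
Hypothesis GE : forall i, i < T -> G i = ~~ U i && ~~ L i.
Hypothesis G_bounds : forall i, i < T -> G i -> y <= i < Tu.

Lemma M_upper_part (S : pred nat) :
  M (upper_part R l S) = M (dented Tu Nu (predU U S)).
Proof.
rewrite -M_dented_triangles //; last by rewrite size_dent_positions leq_addr.
pose f (t : utriangle) : utriangle := (t.1.1, t.1.2 - l, t.2).
pose g (t : utriangle) : utriangle := (t.1.1, l + t.1.2, t.2).
have upE (i j : nat) (b : bool) : ((i, j, b) \in upper_part R l S) =
    (l <= j) && ((f (i, j, b)) \in [fset u in dented Tu Nu S |
                               ~~ dent_triangles true 0 t1 u]%fset).
  rewrite [LHS]in_fset_sep in_fset_sep /f in_dented /level /crossed_up /level /=.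
  case: (leqP l j) => lj /=; last by rewrite andbF.
  rewrite -(subnKC lj); move: (j - l) => m; rewrite addKn R_above /=.
  have -> : (l + m == l) = (m == 0) by lia.
  by case: dent_triangles; rewrite /= ?andbF ?andbT -?andbA.
apply: (@M_transport _ _ f g).
- by move=> [[i j] b]; rewrite upE => /andP[].
- by move=> [[i j] b] uR; rewrite upE /f /= addKn leq_addr.
- by move=> [[i j] b]; rewrite upE => /andP[lj _]; rewrite /g /= subnKC.
- by move=> [[i j] b] _; rewrite /f /= addKn.
- move=> [[i j] b] [[i' j'] b']; rewrite !upE => /andP[lj _] /andP[lj' _].
  by rewrite /f /=; case: b; case: b' => //=; lia.
Qed.

(* The reflection in the cutting line turns the lower part over. *)
Lemma M_lower_part (S : pred nat) : M (lower_part R l S) =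
  M (dented Tl l (predU (mem (dent_positions true 0 t2)) (fun i => S (y + i)))).
Proof.
rewrite -M_dented_triangles //; last by rewrite size_dent_positions lE leq_addr.
pose f (t : utriangle) : utriangle :=
  (t.1.1 + t.1.2 + ~~ t.2 - (l + y), l.-1 - t.1.2, ~~ t.2).
pose g (t : utriangle) : utriangle :=
  (t.1.1 + y + t.1.2 + ~~ t.2, l.-1 - t.1.2, ~~ t.2).
have lowE (i j : nat) (b : bool) : ((i, j, b) \in lower_part R l S) =
    [&& j < l, l + y <= i + j + ~~ b &
     (f (i, j, b)) \in [fset u in dented Tl l (fun i => S (y + i)%N) |
                               ~~ dent_triangles true 0 t2 u]%fset].
  rewrite [LHS]in_fset_sep in_fset_sep /f in_dented /level /crossed_down /level /=.
  case: (ltnP j l) => jl /=; last by rewrite andbF.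
  rewrite R_below //= -!andbA.
  case: (leqP (l + y) (i + j + ~~ b)) => //= yi.
  case: dent_triangles; rewrite /= ?andbF ?andbT //.
  case: b yi => /= yi; first by rewrite !andbT.
  have -> : (l.-1 - j == 0) = (j.+1 == l) by lia.
  case: eqP => [jE|_]; rewrite /= ?andbT //.
  by have -> : y + (i + j + 1 - (l + y)) = i by lia.
apply: (@M_transport _ _ f g).
- by move=> [[i j] b]; rewrite lowE => /and3P[].
- move=> [[i j] b] uR; rewrite lowE.
  have jl : j < l by move: uR; rewrite in_fset_sep in_dented => /andP[/and3P[]].
  have -> : f (g (i, j, b)) = (i, j, b).
    by rewrite /f /g; congr (_, _, _); [case: b {uR} | | case: b {uR}] => /=; lia.
  rewrite uR andbT; case: b {uR} => /=; lia.
- move=> [[i j] b]; rewrite lowE => /and3P[jl yi _]; rewrite /f /g /= negbK.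
  by congr (_, _, _); case: b yi => /=; lia.
- move=> [[i j] b]; rewrite in_fset_sep in_dented => /andP[/and3P[jl _ _] _].
  by rewrite /f /g; congr (_, _, _); [case: b | | case: b] => /=; lia.
- move=> [[i j] b] [[i' j'] b']; rewrite !lowE => /and3P[jl yi _] /and3P[jl' yi' _].
  by rewrite /f /=; case: b yi; case: b' yi' => //=; lia.
Qed.

Lemma R_bound u : u \in R -> u.1.1 < T.
Proof.
case: u => -[i j] b; case: (ltnP j l) => lj /=.
  by rewrite R_below // => /and3P[]; case: b => /=; lia.
by rewrite -(subnKC lj) R_above => /andP[]; case: b => /=; lia.
Qed.

Lemma crossing_above (i : nat) : ((i, l, true) \in R) = [&& 0 < Nu, i < Tu & ~~ U i].
Proof.
by rewrite -{1}[l]addn0 R_above dent_triangles_base /= !addn0 -andbA.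
Qed.

Lemma L_shift i : L (y + i) = (i \in dent_positions true 0 t2).
Proof.
have LE : dent_positions true y t2 = [seq y + k | k <- dent_positions true 0 t2].
  by rewrite -{1}[y]addn0 dent_positions_shift.
by rewrite /L /= LE mem_map //; apply: addnI.
Qed.

Lemma crossing_below (i : nat) : 0 < l ->
  ((i, l.-1, false) \in R) = [&& y <= i, i < T & ~~ L i].
Proof.
move=> l0; rewrite R_below ?prednK //= subnn.
have -> : (l + y <= i + l.-1 + 1) = (y <= i) by lia.
case: (leqP y i) => //= yi; have -> : i + l.-1 + 1 - (l + y) = i - y by lia.
rewrite l0 dent_triangles_base -L_shift subnKC //= !addn0.
by have -> : (i - y < Tl) = (i < T) by lia.
Qed.

Lemma L_bounds i : L i -> y <= i < T.
Proof.
by move=> /(allP (dent_positions_bounds true y t2)); lia.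
Qed.

Lemma U_bound i : U i -> i < Tu.
Proof.
by move=> /(allP (dent_positions_bounds true 0 t1)); lia.
Qed.

Section Crossing.
Variable S : {set 'I_T}.
Hypothesis SG : forall i : 'I_T, i \in S -> G i.

Lemma nat_in_gap i : nat_in S i -> G i.
Proof.
move=> iS; have := iS; rewrite -[i]/(val (Ordinal (nat_in_lt iS))) nat_in_ord.
exact: SG.
Qed.

Lemma nat_in_gap_bounds i : nat_in S i -> y <= i < Tu.
Proof. by move=> iS; apply: G_bounds (nat_in_lt iS) (nat_in_gap iS). Qed.

Lemma size_dents (V : pred nat) (s : seq nat) : V =1 mem s -> sorted ltn s ->
  all (fun i => i < T) s -> (forall i, i < T -> V i -> ~~ G i) ->
  size [seq i <- iota 0 T | predU V (nat_in S) i] = size s + #|S|.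
Proof.
move=> VE srt bnd VG; rewrite size_filter -count_nat_in.
have -> : size s = count V (iota 0 T).
  rewrite -size_filter; congr size; rewrite -[LHS](@filter_iota_mem s 0 T) //.
  by apply: eq_filter => i; rewrite VE.
rewrite -count_predUI [X in _ = _ + X](_ : _ = 0) ?addn0 //.
apply/eqP; rewrite -leqn0 leqNgt -has_count; apply/negP => /hasP[i].
rewrite mem_iota /= => iT /andP[/(VG _ iT)/negP nG iS].
exact: nG (nat_in_gap iS).
Qed.

Let dents_U := [seq i <- iota 0 T | predU U (nat_in S) i].
Let dents_L := [seq i <- iota 0 T | predU L (nat_in S) i].

Lemma size_dents_U : size dents_U = osum t1 + #|S|.
Proof.
rewrite (@size_dents _ (dent_positions true 0 t1)) ?size_dent_positions //.
- exact: dent_positions_sorted.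
- by apply: sub_all (dent_positions_bounds _ _ _) => i; lia.
- by move=> i iT Ui; rewrite GE // Ui.
Qed.

Lemma size_dents_L : size dents_L = osum t2 + #|S|.
Proof.
rewrite (@size_dents _ (dent_positions true y t2)) ?size_dent_positions //.
- exact: dent_positions_sorted.
- by apply: sub_all (dent_positions_bounds _ _ _) => i; lia.
- by move=> i iT Li; rewrite GE // Li andbF.
Qed.

Lemma M_upper_part_count : (0 < Nu) || (S == set0) ->
  ((M (upper_part R l (nat_in S)))%:R = dent_count Nu dents_U)%R.
Proof.
move=> N0; rewrite M_upper_part.
have UE : [seq i <- iota 0 Tu | predU U (nat_in S) i] = dents_U.
  rewrite /dents_U (filter_iota_widen Tu_le) // => i /orP[/U_bound //|].
  by move/nat_in_gap_bounds; lia.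
rewrite M_dented // UE // -size_eq0 size_dents_U.
by case/orP: N0 => [->//|/eqP ->]; rewrite cards0 addn0 /Nu; lia.
Qed.

Lemma M_lower_part_count : (0 < l) || (S == set0) ->
  ((M (lower_part R l (nat_in S)))%:R = dent_count l dents_L)%R.
Proof.
move=> N0; rewrite M_lower_part.
pose dl := [seq i <- iota 0 Tl |
  predU (mem (dent_positions true 0 t2)) (fun i => nat_in S (y + i)) i].
have LE : dents_L = [seq y + i | i <- dl].
  have -> : dents_L = [seq i <- iota 0 (y + Tl) | predU L (nat_in S) i].
    by rewrite -TE.
  rewrite filter_iota_shift.
    by congr map; apply: eq_filter => i; rewrite /= -L_shift.
  by move=> i /orP[/L_bounds|/nat_in_gap_bounds] /andP[].
have sz : size dl = osum t2 + #|S| by rewrite -size_dents_L LE size_map.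
rewrite M_dented //; first by rewrite /dent_count -/dl LE vdm_shift size_map.
rewrite -/dl -size_eq0 sz.
by case/orP: N0 => [->//|/eqP ->]; rewrite cards0 addn0 lE; lia.
Qed.

End Crossing.

Lemma cut_term_count (S : {set 'I_T}) :
  ((cut_term R l S)%:R =
   if [forall i in S, G i] && (#|S| == z) then
     vdm (dent_positions true 0 t1) * vdm (dent_positions true 0 t2)
     / (H Nu * H l) * pair_prod T (gap_weight G (nat_in S)) else 0)%R.
Proof.
have [SG|SG] /= := boolP [forall i in S, G i]; last first.
  rewrite /cut_term; case: ifP => // /forallP cr; case/forallP: SG => i.
  have := cr i; case: (i \in S) => //=; rewrite /crossing crossing_above.
  by case/and3P=> l0; rewrite crossing_below // GE // => /and3P[_ _ ->] /and3P[_ _ ->].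
have {}SG (i : 'I_T) : i \in S -> G i by move/forallP: SG => /(_ i)/implyP.
have sU := size_dents_U SG; have sL := size_dents_L SG.
(* A set of [z] positions in the gaps always fits: if it is nonempty then [z] provides a row on each
   side, and [G_bounds] places the gaps on both bases. *)
rewrite /cut_term; case: ifPn => [cr|ncr]; last first.
  case: eqP => // Sz; case/negP: ncr; apply/forallP => i; apply/implyP => iS.
  have z0 : 0 < z by rewrite -Sz; apply/card_gt0P; exists i.
  have l0 : 0 < l by lia.
  have Gi := SG i iS; have bi := G_bounds (ltn_ord i) Gi.
  move: Gi; rewrite GE // => /andP[nU nL].
  rewrite /crossing l0 crossing_below // crossing_above nU nL ltn_ord.
  by rewrite /Nu; lia.
have N0 : ((0 < Nu) && (0 < l)) || (S == set0).
  have [_|/set0Pn[i iS]] := eqVneq S set0; rewrite ?orbT // orbF.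
  move/forallP: cr => /(_ i); rewrite iS /= => /and3P[-> _].
  by rewrite crossing_above => /and3P[->].
rewrite natrM (M_upper_part_count SG); last first.
  by case/orP: N0 => [/andP[->]|->]; rewrite ?orbT.
rewrite (M_lower_part_count SG); last first.
  by case/orP: N0 => [/andP[_ ->]|->]; rewrite ?orbT.
(* Each half requires as many dents as rows; both requirements become [#|S| = z]. *)
rewrite /dent_count sU sL {1}lE eqn_add2l /Nu eqn_add2l.
case: eqP => _; last by rewrite mulr0.
have fac := @vdm_gap_factor T U L (nat_in S) G UL GE (fun i _ => @nat_in_gap S SG i).
have UE : [seq i <- iota 0 T | U i] = dent_positions true 0 t1.
  apply: filter_iota_mem; first exact: dent_positions_sorted.
  by apply: sub_all (dent_positions_bounds _ _ _) => i; lia.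
have LE : [seq i <- iota 0 T | L i] = dent_positions true y t2.
  apply: filter_iota_mem; first exact: dent_positions_sorted.
  by apply: sub_all (dent_positions_bounds _ _ _) => i; lia.
have vL : vdm (dent_positions true y t2) = vdm (dent_positions true 0 t2).
  by rewrite -{1}[y]addn0 dent_positions_shift vdm_shift.
move: fac; rewrite UE LE vL => fac.
rewrite [RHS]mulrAC -fac invfM; ring.
Qed.

Theorem M_glued : ((M R)%:R =
   vdm (dent_positions true 0 t1) * vdm (dent_positions true 0 t2)
     / (H (osum t1 + z) * H (osum t2 + z)) * gap_sum T z G)%R.
Proof.
rewrite (M_cut (n := T) l R_bound) natr_sum /gap_sum mulr_sumr [RHS]big_mkcond /=.
by apply: eq_bigr => S _; rewrite cut_term_count -lE.
Qed.

End Gluing.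

(** * Regions with ferns removed *)

Lemma osum_cat t1 t2 :
  osum (t1 ++ t2) = osum t1 + (if odd (size t1) then esum t2 else osum t2)
with esum_cat t1 t2 :
  esum (t1 ++ t2) = esum t1 + (if odd (size t1) then osum t2 else esum t2).
Proof.
- case: t1 => [|n t1] /=; first by rewrite {2}/osum big_ord0.
  by rewrite !osum_cons esum_cat addnA if_neg.
- case: t1 => [|n t1] /=; first by rewrite {2}/esum big_ord0.
  by rewrite !esum_cons osum_cat if_neg.
Qed.

Lemma osum_nil : osum [::] = 0. Proof. by rewrite /osum big_ord0. Qed.
Lemma esum_nil : esum [::] = 0. Proof. by rewrite /esum big_ord0. Qed.

Definition osumE := (osum_cat, esum_cat, osum_cons, esum_cons, osum_nil, esum_nil).

Lemma osum_rev t : osum (rev t) = if odd (size t) then osum t else esum t.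
Proof.
have [] : osum (rev t) = (if odd (size t) then osum t else esum t) /\
          esum (rev t) = (if odd (size t) then esum t else osum t); last by [].
elim: t => [|n t [IHo IHe]]; first by rewrite !osumE.
rewrite rev_cons -cats1 !osumE IHo IHe size_rev /=.
by case: odd => /=; split; lia.
Qed.

Lemma init_seqK t : 0 < size t -> rcons (init_seq t) (last 0 t) = t.
Proof.
case/lastP: t => // t n _; rewrite /init_seq last_rcons size_rcons /=.
by rewrite -[in take _ _]cats1 take_size_cat.
Qed.

Lemma head_behead t : 0 < size t -> head 0 t :: behead t = t.
Proof. by case: t. Qed.

(** Along a fern this makes the dents seen from above and those seen from below complementary. *)
Lemma dent_positions_compl up p t i : p <= i < p + sumn t ->
  (i \in dent_positions (~~ up) p t) = (i \notin dent_positions up p t).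
Proof.
elim: t up p => [|n t IHt] up p /=; first by lia.
rewrite !mem_cat => ip; have [lt|ge] := ltnP i (p + n).
  have nin b : (i \in dent_positions b (p + n) t) = false.
    by apply/negP => /(allP (dent_positions_bounds _ _ _)); lia.
  by rewrite !nin !orbF; case: up; rewrite /= mem_iota ?in_nil; lia.
have nin : (i \in iota p n) = false by rewrite mem_iota; lia.
rewrite IHt; last by lia.
by case: up; rewrite /= ?nin ?in_nil.
Qed.

Lemma odd_size_init_seq t : 0 < size t -> ~~ odd (size t) -> odd (size (init_seq t)).
Proof. by move=> t0; rewrite -{1}(init_seqK t0) size_rcons /= negbK. Qed.

Lemma odd_size_behead (t : seq nat) :
  0 < size t -> ~~ odd (size t) -> odd (size (behead t)).
Proof. by case: t => //= n t _; rewrite negbK. Qed.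

Lemma sumn_init_seq t : 0 < size t -> sumn (init_seq t) + last 0 t = sumn t.
Proof. by move=> t0; rewrite -{3}(init_seqK t0) sumn_rcons. Qed.

(** With even length the last entry is a distance and can be merged into the next one: the origin of
    entries such as [last 0 c + h + last 0 b]. *)
Lemma dent_triangles_init p t u : 0 < size t -> ~~ odd (size t) ->
  dent_triangles true p t u = dent_triangles true p (init_seq t) u.
Proof.
move=> t0 te; rewrite -{1}(init_seqK t0) -cats1 dent_triangles_cat odd_size_init_seq //=.
by rewrite orbF.
Qed.

Lemma dent_triangles_behead p t u : 0 < size t ->
  dent_triangles false p t u = dent_triangles true (p + head 0 t) (behead t) u.
Proof. by case: t. Qed.

Lemma dent_triangles_rev p t u : 0 < size t ->
  dent_triangles false p (rev t) u =
  dent_triangles true (p + last 0 t) (rev (init_seq t)) u.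
Proof. by move=> t0; rewrite -{1}(init_seqK t0) rev_rcons. Qed.

Lemma in_hexagon sN sNE sSE sS sSW sNW i j b :
  sN + sNE = sS + sSW -> sNE + sSE = sSW + sNW ->
  ((i, j, b) \in hexagon sN sNE sSE sS sSW sNW) =
  [&& i < sSW + sS, j < sSW + sNW, sSW <= i + j + ~~ b &
      i + j + ~~ b < sSW + sS + sSE].
Proof.
move=> e1 e2; rewrite in_fset_sep mem_parallelogram e1 e2 !eqxx /=.
by case: b => /=; lia.
Qed.

Definition two_gaps (Y h C i : nat) : bool :=
  (Y <= i < Y + h) || (Y + h + C <= i < Y + h + C + h).

(** The cut follows the base of the core, [Y] rows below the west vertex and [Y] rows above the east
    vertex. Hence a corner of side [Y] is completed at the left of the upper half and another at the
    right of the lower half. *)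
Lemma M_cored_hexagon x z Y C : x = z %[mod 2] ->
  let h := (x + z)./2 in
  ((M (cored_hexagon x (2 * Y + z) z C))%:R =
   H Y * H C * H (Y + h + C) * H h / (H (h + C) * H (Y + h)) * H Y
   / (H (Y + C + z) * H (Y + z))
   * gap_sum (Y + h + C + h + Y) z (two_gaps Y h C))%R.
Proof.
move=> xz h; have hE : x + z = 2 * h by rewrite /h; lia.
(* The entry 0 appears because a pattern starts with a dent, and the lower half has none at its left
   end. *)
pose t1 := [:: Y; h; C]; pose t2 := [:: 0; h + C + h; Y].
have o1 : osum t1 = Y + C by rewrite !osumE !addn0.
have o2 : osum t2 = Y by rewrite !osumE addn0.
have tri1 u : dent_triangles true 0 t1 u =
    in_triangle true (0, 0) Y u || in_triangle true (Y + h, 0) C u.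
  by rewrite /= orbF.
have tri2 u : dent_triangles true 0 t2 u = in_triangle true (h + C + h, 0) Y u.
  case: u => -[i j] u; rewrite /= orbF in_triangle_upE.
  by case: andP => // -[]; lia.
(* The three parities agree, so the core starts at the center itself. *)
have core : core_vertex x (2 * Y + z) z = (Y + h, Y + z).
  rewrite /core_vertex (_ : odd x = odd z); last by lia.
  rewrite (_ : odd (2 * Y + z) = odd z) ?eqxx /=; last by lia.
  by congr pair; lia.
have pos1 i : (i \in dent_positions true 0 t1) = (i < Y) || (Y + h <= i < Y + h + C).
  by rewrite -dent_triangles_base tri1 !in_triangle_upE /=; lia.
have pos2 i : (i \in dent_positions true Y t2) =
    (Y + h + C + h <= i < Y + h + C + h + Y).
  rewrite /= cats0 mem_iota; lia.
have memC (i j : nat) (u : bool) : ((i, j, u) \in cored_hexagon x (2 * Y + z) z C) =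
    [&& i < Y + h + C + h + Y, j < 2 * Y + z + z + C, 2 * Y + z <= i + j + ~~ u,
        i + j + ~~ u < 2 * Y + z + C + h + h &
        ~~ in_triangle true (Y + h, Y + z) C (i, j, u)].
  rewrite in_fset_sep core in_hexagon; [|lia..]; rewrite -!andbA.
  by congr [&& _, _, _, _ & _]; lia.
rewrite (@M_glued _ (Y + z) (Y + h + C + h + Y) (Y + h + C + h) (h + C + h + Y) Y z
  t1 t2 (two_gaps Y h C)); first last.
- by move=> i iT; rewrite /two_gaps; lia.
- by move=> i iT; rewrite /= pos1 pos2 /two_gaps; lia.
- by move=> i iT; rewrite /= pos1 pos2; lia.
- move=> i j u jl; rewrite memC tri2 !in_triangle_upE; case: u => /=; lia.
- move=> i j u; rewrite memC tri1 !in_triangle_upE o1; case: u => /=; lia.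
- by lia.
- by rewrite o1; lia.
- by rewrite /=; lia.
- by rewrite /=; lia.
- by lia.
- by lia.
- by rewrite o2.
have -> : dent_positions true 0 t1 = iota 0 Y ++ iota (Y + h) C by rewrite /= cats0.
have -> : dent_positions true 0 t2 = iota (h + C + h) Y by rewrite /= cats0.
by rewrite vdm_two_intervals vdm_iota o1 o2.
Qed.

Section ThreeFerns.
Variables (x y z : nat) (a b c : seq nat).
Hypotheses (xz : x = z %[mod 2])
  (m_gt0 : 0 < size a) (m_even : ~~ odd (size a))
  (n_gt0 : 0 < size b) (n_even : ~~ odd (size b))
  (k_gt0 : 0 < size c) (k_even : ~~ odd (size c)).

Let h := (x + z)./2.
Let A := sumn a.
Let B := sumn b.
Let C := sumn c.
(** Truncated subtraction treats both cases of the theorem at once. [yl] and [yr] are the sides of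
    the corners completed at the left above the line and at the right below it; [Y] is [y] plus the
    larger of [A] and [B]. *)
Let yl := y + (B - A).
Let yr := y + (A - B).
Let Y := yl + A.

Let upper_dents : seq nat := yl :: a ++ h :: init_seq c
              ++ (last 0 c + h + last 0 b) :: rev (init_seq b).
Let lower_dents : seq nat := init_seq a ++ (last 0 a + h + head 0 c) :: behead c
              ++ h :: rev b ++ [:: yr].

Let hE : x + z = 2 * h.
Proof. by rewrite /h; lia. Qed.

Lemma osum_upper_dents : osum upper_dents = yl + esum a + osum c + osum b.
Proof.
rewrite /upper_dents !osumE osum_rev (negPf m_even) !odd_size_init_seq //.
rewrite -{2}(init_seqK k_gt0) -{2}(init_seqK n_gt0) -!cats1 !osumE !odd_size_init_seq //.
by rewrite ?osumE; lia.
Qed.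

Lemma osum_lower_dents : osum lower_dents = osum a + esum c + esum b + yr.
Proof.
rewrite /lower_dents !osumE osum_rev size_rev (negPf n_even).
rewrite odd_size_init_seq // odd_size_behead //.
rewrite -{2}(init_seqK m_gt0) -{2}(head_behead k_gt0) -!cats1 !osumE.
rewrite !odd_size_init_seq //.
by rewrite ?osumE; lia.
Qed.

Lemma sumn_upper_dents : sumn upper_dents = yl + A + h + C + h + B.
Proof.
rewrite /upper_dents /= sumn_cat /= sumn_cat /= sumn_rev.
by have := sumn_init_seq k_gt0; have := sumn_init_seq n_gt0; rewrite -/B -/C -/A; lia.
Qed.

Lemma sumn_lower_dents : sumn lower_dents = A + h + C + h + B + yr.
Proof.
rewrite /lower_dents /= sumn_cat /= sumn_cat /= sumn_cat /= sumn_rev.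
have := sumn_init_seq m_gt0; have : head 0 c + sumn (behead c) = C.
  by rewrite /C -{3}(head_behead k_gt0).
by rewrite -/B -/A; lia.
Qed.

Lemma upper_dent_triangles u : dent_triangles true 0 upper_dents u =
  [|| in_triangle true (0, 0) yl u, dent_triangles false yl a u,
      dent_triangles true (Y + h) c u |
      dent_triangles false (Y + h + C + h) (rev b) u].
Proof.
rewrite /upper_dents /= dent_triangles_cat (negPf m_even) /= -/A -/Y.
rewrite dent_triangles_cat odd_size_init_seq //= dent_triangles_rev //.
rewrite -dent_triangles_init //.
have -> // : Y + h + sumn (init_seq c) + (last 0 c + h + last 0 b) =
  Y + h + C + h + last 0 b.
by have := sumn_init_seq k_gt0; rewrite -/C; lia.
Qed.

Lemma lower_dent_triangles u : dent_triangles true 0 lower_dents u =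
  [|| dent_triangles true 0 a u, dent_triangles false (A + h) c u,
      dent_triangles true (A + h + C + h) (rev b) u |
      in_triangle true (A + h + C + h + B, 0) yr u].
Proof.
have sc : head 0 c + sumn (behead c) = C.
  by rewrite /C -{3}(head_behead k_gt0).
have sa := sumn_init_seq m_gt0; rewrite -/A in sa.
rewrite /lower_dents dent_triangles_cat odd_size_init_seq //=.
rewrite dent_triangles_cat odd_size_behead //=.
rewrite dent_triangles_cat size_rev (negPf n_even) /= orbF sumn_rev -/B add0n.
rewrite -dent_triangles_init // dent_triangles_behead //.
have -> : sumn (init_seq a) + (last 0 a + h + head 0 c) = A + h + head 0 c by lia.
by have -> : A + h + head 0 c + sumn (behead c) + h = A + h + C + h by lia.
Qed.

Let G := two_gaps Y h C.
Let T := Y + h + C + h + Y.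

Let YE : Y = yr + B.
Proof. by rewrite /Y /yl /yr; lia. Qed.

Let pos_out up p t i : ~~ (p <= i < p + sumn t) ->
  (i \in dent_positions up p t) = false.
Proof.
move=> nb; apply/negP => /(allP (dent_positions_bounds _ _ _)) ib.
by rewrite ib in nb.
Qed.

(** The line splits into corner, fern, gap, fern, gap, fern, corner. A corner gives dents on one
    side only, and along a fern the two sides are complementary. *)
Lemma three_fern_gaps i : i < T ->
  ~~ ((i \in dent_positions true 0 upper_dents) &&
      (i \in dent_positions true yl lower_dents))
  /\ G i = (i \notin dent_positions true 0 upper_dents) &&
           (i \notin dent_positions true yl lower_dents).
Proof.
move=> iT.
have -> : (i \in dent_positions true yl lower_dents) =
    (yl <= i) && (i - yl \in dent_positions true 0 lower_dents).
  have [yi|yi] /= := leqP yl i; last by rewrite pos_out //; lia.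
  by rewrite -{1}[yl]addn0 dent_positions_shift -{1}(subnKC yi) mem_map //; apply: addnI.
rewrite -!dent_triangles_base upper_dent_triangles lower_dent_triangles.
rewrite !dent_triangles_base !in_triangle_upE !addn0 /=.
have shift up p t : yl <= i -> (i - yl \in dent_positions up p t) =
    (i \in dent_positions up (yl + p) t).
  by move=> yi; rewrite dent_positions_shift -{2}(subnKC yi) mem_map //; apply: addnI.
have [yi|yi] /= := ltnP i yl.
  by rewrite /G /two_gaps; split=> //; lia.
rewrite !shift // addn0 (_ : yl + (A + h) = Y + h); last by lia.
rewrite (_ : yl + (A + h + C + h) = Y + h + C + h); last by lia.
have compl p t : p <= i < p + sumn t ->
    (i \in dent_positions true p t) = (i \notin dent_positions false p t).
  exact: (dent_positions_compl false).
have sA : sumn a = A by []. have sC : sumn c = C by [].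
have sB : sumn (rev b) = B by rewrite sumn_rev.
have [i1|i1] := ltnP i Y.
  rewrite !(pos_out _ (p := Y + h)) ?(pos_out _ (p := Y + h + C + h)); try lia.
  rewrite compl; last by lia.
  rewrite /G /two_gaps; case: (i \in _) => /=; split; lia.
rewrite !(pos_out _ (p := yl)); try lia.
have [i2|i2] := ltnP i (Y + h + C).
  rewrite !(pos_out _ (p := Y + h + C + h)); try lia.
  have [i3|i3] := ltnP i (Y + h).
    rewrite !(pos_out _ (p := Y + h)); try lia.
    by rewrite /G /two_gaps; split; lia.
  rewrite compl; last by lia.
  rewrite /G /two_gaps; case: (i \in _) => /=; split; lia.
rewrite !(pos_out _ (p := Y + h)); try lia.
have [i4|i4] := ltnP i (Y + h + C + h).
  rewrite !(pos_out _ (p := Y + h + C + h)); try lia.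
  by rewrite /G /two_gaps; split; lia.
have [i5|i5] := ltnP i (Y + h + C + h + B).
  rewrite compl; last by lia.
  rewrite /G /two_gaps; case: (i \in _) => /=; split; lia.
rewrite !(pos_out _ (p := Y + h + C + h)); try lia.
by rewrite /G /two_gaps; split; lia.
Qed.

Lemma M_three_fern_region : ((M (three_fern_region x y z a c b))%:R =
  vdm (dent_positions true 0 upper_dents) * vdm (dent_positions true 0 lower_dents)
  / (H (osum upper_dents + z) * H (osum lower_dents + z)) * gap_sum T z G)%R.
Proof.
have oA := osumDesum a; have oB := osumDesum b; have oC := osumDesum c.
rewrite -/A -/B -/C in oA oB oC.
have oU := osum_upper_dents; have oL := osum_lower_dents.
have sU := sumn_upper_dents; have sL := sumn_lower_dents.
have gaps := three_fern_gaps.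
have eyl : yl = y + (B - A) by [].
have eyr : yr = y + (A - B) by [].
have eY : Y = yl + A by [].
have eT : T = Y + h + C + h + Y by [].
pose l := osum lower_dents + z.
pose Nu := osum upper_dents + z.
pose Tu := Y + h + C + h + B.
(* The side-lengths enter only through the line: [l] rows lie below it and [Nu] rows above it. *)
have memR (i j : nat) (u : bool) :
    ((i, j, u) \in three_fern_region x y z a c b) =
    [&& [&& i < T, j < l + Nu, l + yl <= i + j + ~~ u & i + j + ~~ u < l + Tu],
        ~~ in_fern false (yl, l) a (i, j, u),
        ~~ in_fern true (Y + h, l) c (i, j, u) &
        ~~ in_fern false (Y + h + C + h, l) (rev b) (i, j, u)].
  rewrite in_fset_sep in_hexagon; first last.
  - by rewrite /absdiff -/A -/B; lia.
  - by rewrite /absdiff -/A -/B; lia.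
  rewrite (negPf n_even) -/A -/B -/C -/h /absdiff.
  congr [&& _, ~~ in_fern _ (_, _) _ _, ~~ in_fern _ (_, _) _ _ &
            ~~ in_fern _ (_, _) _ _].
  - by congr [&& _, _, _ & _]; lia.
  - by lia.
  - by lia.
  - by lia.
  - by lia.
  - by lia.
  - by lia.
apply: (@M_glued _ l T Tu (A + h + C + h + B + yr) yl z upper_dents lower_dents) => //.
- by lia.
- by lia.
- by lia.
- by lia.
- by lia.
- by lia.
- move=> i j u; rewrite memR !in_fern_above ?leq_addr // addKn.
  rewrite upper_dent_triangles !negb_or in_triangle_upE /= -/Nu.
  do 3!case: dent_triangles; rewrite ?andbF ?andbT //=; case: u => /=; lia.
- move=> i j u jl; rewrite memR.
  have [yi|yi] /= := leqP (l + yl) (i + j + ~~ u); last by rewrite !andbF.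
  have -> : in_fern false (yl, l) a (i, j, u) = dent_triangles true 0 a
      (i + j + ~~ u - (l + yl), l.-1 - j, ~~ u).
    by rewrite -(@in_fern_below false 0 yl) // addn0.
  have -> : in_fern true (Y + h, l) c (i, j, u) = dent_triangles false (A + h) c
      (i + j + ~~ u - (l + yl), l.-1 - j, ~~ u).
    by rewrite -(@in_fern_below true (A + h) yl) // addnA.
  have -> : in_fern false (Y + h + C + h, l) (rev b) (i, j, u) =
      dent_triangles true (A + h + C + h) (rev b)
      (i + j + ~~ u - (l + yl), l.-1 - j, ~~ u).
    by rewrite -(@in_fern_below false (A + h + C + h) yl) // !addnA.
  rewrite lower_dent_triangles !negb_or in_triangle_upE.
  move: (dent_triangles true 0 a _) (dent_triangles false (A + h) c _)
    (dent_triangles true _ (rev b) _) => d1 d2 d3.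
  case: d1; case: d2; case: d3; rewrite /= ?andbF ?andbT //=; case: u yi => /= yi; lia.
- by move=> i /gaps[].
- by move=> i /gaps[].
- by move=> i iT; rewrite /G /two_gaps; lia.
Qed.

(** The common [gap_sum] is eliminated between the two counts. The factors in [C], [h] and [Y] stem
    from the dents of the cored hexagon, and [H (osum _)] from replacing [vdm] by [s]. *)
Lemma three_fern_formula : ((M (three_fern_region x y z a c b))%:R =
  (M (cored_hexagon x (2 * Y + z) z C))%:R
  * (s upper_dents)%:R * (s lower_dents)%:R
  * (H (C + h) / (H C * H h))
  * (H (Y + h) / H (Y + C + h))
  * (H (Y + z) * H (Y + C + z)
     / (H (osum upper_dents + z) * H (osum lower_dents + z)))
  * (H (osum upper_dents) * H (osum lower_dents) / H Y ^+ 2))%R.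
Proof.
rewrite M_three_fern_region M_cored_hexagon // !s_vdm -/h -/G -/T.
rewrite (addnC C h) (addnAC Y C h).
by field; rewrite !H_neq0.
Qed.

End ThreeFerns.

Theorem theorem2p2 (x y z : nat) (a b c : seq nat)
  (xz : x = z %[mod 2])
  (m_gt0 : 0 < size a) (m_even : ~~ odd (size a))
  (n_gt0 : 0 < size b) (n_even : ~~ odd (size b))
  (k_gt0 : 0 < size c) (k_even : ~~ odd (size c)) :
  let h := (x + z)./2 in
  let A := sumn a in
  let B := sumn b in
  let C := sumn c in
  (B <= A ->
    ((M (three_fern_region x y z a c b))%:R =
      (M (cored_hexagon x (2 * y + z + 2 * A) z C))%:R
      * (s (y :: a ++ h :: init_seq c
              ++ (last 0 c + h + last 0 b) :: rev (init_seq b))%N)%:R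
      * (s (init_seq a ++ (last 0 a + h + head 0 c) :: behead c
              ++ h :: rev b ++ [:: y + A - B])%N)%:R
      * (H (C + h) / (H C * H h))
      * (H (A + y + h) / H (A + C + y + h))
      * (H (A + y + z) * H (A + C + y + z)
         / (H (esum a + osum b + osum c + y + z)
            * H (A + osum a - osum b + esum c + y + z)))
      * (H (esum a + osum b + osum c + y)
         * H (A + osum a - osum b + esum c + y)
         / H (A + y) ^+ 2))%R) /\
  (A < B ->
    ((M (three_fern_region x y z a c b))%:R =
      (M (cored_hexagon x (2 * y + z + 2 * B) z C))%:R
      * (s ((y + B - A) :: a ++ h :: init_seq c
              ++ (last 0 c + h + last 0 b) :: rev (init_seq b))%N)%:R
      * (s (init_seq a ++ (last 0 a + h + head 0 c) :: behead c
              ++ h :: rev b ++ [:: y])%N)%:R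
      * (H (C + h) / (H C * H h))
      * (H (B + y + h) / H (B + C + y + h))
      * (H (B + y + z) * H (B + C + y + z)
         / (H (B + osum b - osum a + osum c + y + z)
            * H (osum a + esum b + esum c + y + z)))
      * (H (B + osum b - osum a + osum c + y)
         * H (osum a + esum b + esum c + y)
         / H (B + y) ^+ 2))%R).
Proof.
have formula := three_fern_formula y xz m_gt0 m_even n_gt0 n_even k_gt0 k_even.
have oU := osum_upper_dents y xz m_gt0 m_even n_gt0 n_even k_gt0 k_even.
have oL := osum_lower_dents y xz m_gt0 m_even n_gt0 n_even k_gt0 k_even.
have oA := osumDesum a; have oB := osumDesum b.
move=> h A B C; rewrite -/h -/A -/B -/C in formula oU oL oA oB.
split=> AB.
- have e1 : y + (B - A) = y by lia.
  have e2 : y + (A - B) = y + A - B by lia.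
  rewrite e1 e2 in formula oU oL.
  have e3 : 2 * (y + A) + z = 2 * y + z + 2 * A by lia.
  have e4 : y + A + C = A + C + y by lia.
  have e5 : y + A = A + y by lia.
  have e6 : y + esum a + osum c + osum b = esum a + osum b + osum c + y by lia.
  (* No subtraction truncates, because [osum b <= B <= A]; in the other case [osum a <= A < B]. *)
  have e7 : osum a + esum c + esum b + (y + A - B) =
    A + osum a - osum b + esum c + y by lia.
  by rewrite formula oU oL e3 e4 e6 e7 e5.
- have e1 : y + (B - A) = y + B - A by lia.
  have e2 : y + (A - B) = y by lia.
  rewrite e1 e2 in formula oU oL.
  have e3 : 2 * (y + B - A + A) + z = 2 * y + z + 2 * B by lia.
  have e4 : y + B - A + A + C = B + C + y by lia.
  have e5 : y + B - A + A = B + y by lia.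
  have e6 : y + B - A + esum a + osum c + osum b =
    B + osum b - osum a + osum c + y by lia.
  have e7 : osum a + esum c + esum b + y = osum a + esum b + esum c + y by lia.
  by rewrite formula oU oL e3 e4 e5 e6 e7.
Qed.
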